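(* Let $I$ be a left ideal of the Weyl algebra $D$ such that $M=D/I$ is holonomic, let $w\in\mathbf{R}^n$ be a weight vector with $w_i>0$ for all $i$, and let $$D^p[\mathbf{s}]\xrightarrow{\ \cdot A\ }D^q[\mathbf{t}]\xrightarrow{\ \cdot B\ }D^r[\mathbf{u}]$$ be a part ($A=\psi_{d+1}$, $B=\psi_d$ for some $d\ge 0$) of an adapted free resolution of $M$ associated to $w$. Let $k_1$ be the maximal integral root of the $b$-function of $M$ associated to the weight $(-w,w)$. Then the map induced by truncation $$\tau_{m',m}\ :\ \frac{\mathrm{Ker}\,\tau_{m'}(\bar A^T)}{\mathrm{Im}\,\tau_{m'}(\bar B^T)}\longrightarrow\frac{\mathrm{Ker}\,\tau_{m}(\bar A^T)}{\mathrm{Im}\,\tau_{m}(\bar B^T)}$$ is an isomorphism of vector spaces when $m'>m\ge k_1$ ($m',m$ integers).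
   Context: Let $K=\mathbf{C}$, $D=K\langle x_1,\dots,x_n,\partial_1,\dots,\partial_n\rangle$ the Weyl algebra, $\hat{\mathcal O}=K[[x_1,\dots,x_n]]$; $\bullet$ denotes the action of differential operators on power series. Elements of $D^p$ are row vectors, and a $p\times q$ matrix $A$ over $D$ gives the left $D$-linear map $\cdot A: D^p\to D^q$, $Q\mapsto QA$. We write $\mathbf N_0=\{0,1,2,\dots\}$ and $\mathbf{e}^j$ for the $j$-th standard vector. Orders and initial parts: for a degree shift vector $\mathbf{t}\in\mathbf{Z}^q$, a nonzero $P=\sum c_{\alpha\beta j}x^\alpha\partial^\beta \mathbf{e}^j\in D^q$ has $\mathrm{ord}_{(-w,w)}[\mathbf t](P)=\max\{w\cdot(\beta-\alpha)+t_j : c_{\alpha\beta j}\ne0\}$, and $\mathrm{in}_{(-w,w)}[\mathbf t](P)\in D^q$ is the sum of the terms of $P$ attaining this maximum (and $\mathrm{in}(0)=0$). For a left submodule $N\subset D^q$, $\mathrm{in}_{(-w,w)}[\mathbf t](N)$ is the left submodule of $D^q$ generated by the initial parts of the elements of $N$. $D^q[\mathbf t]$ denotes $D^q$ with degree shift $\mathbf t$. Adapted resolution: a free resolution $$\cdots\xrightarrow{\psi_{2}}D^{b_1}[\mathbf{m}_1]\xrightarrow{\psi_1}D^{b_0}[\mathbf{m}_0]\to M\to0,\qquad b_0=1,\ \mathbf m_0=(0),$$ of $M=D/I$, with degree shifts $\mathbf{m}_i\in\mathbf{Z}^{b_i}$ such that every nonzero row $R$ of the matrix $\psi_{i+1}$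 satisfies $\mathrm{ord}_{(-w,w)}[\mathbf m_i](R)=$ the corresponding entry of $\mathbf m_{i+1}$, is called adapted (for $w$) if at every object $D^{b_i}[\mathbf m_i]$: (1) the kernel of the outgoing map ($\cdot\psi_i$ for $i\ge1$, the projection $D\to M$ for $i=0$) is generated by the rows of $\psi_{i+1}$; and (2) $\mathrm{in}_{(-w,w)}[\mathbf m_i]$ of this kernel is generated by $\mathrm{in}_{(-w,w)}[\mathbf m_i](R)$, $R$ running over the rows of $\psi_{i+1}$. By convention $\psi_0=0$ with $D^{b_{-1}}=0$. $b$-function: the $b$-function of $M=D/I$ associated to $(-w,w)$ is the monic generator $b(s)$ of the ideal $\{b\in K[s] : b(\sum_i w_ix_i\partial_i)\in\mathrm{in}_{(-w,w)}(I)\}$ (nonzero since $M$ is holonomic); $k_1$ is its maximal integral root. Matrices and truncation: a vector $c=(c_{k\ell})_{k\in\mathbf N_0^n,\,1\le\ell\le q}$ with $c_{k\ell}\in K$ is identified with $\sigma(c)=\sum_{k,\ell}\frac{c_{k\ell}}{k!}x^k\mathbf e^\ell\in\hat{\mathcal O}^q$. The space of such vectors is $(K^{n\infty})^q[\mathbf t]$; the index $(k,\ell)$ has degree $w\cdot k+t_\ell$, and $(K^{n\infty})^q[\mathbf t]_{\le m}$ is the finite-dimensional space of vectors with indices of degree $\le m$ only. Indices are sorted by increasing degree (ties broken by a fixed order). For a $p\times q$ matrix $A=(A^j_\ell)$, define $a^{ij}_{k\ell}\in K$ ($i,k\in\mathbf N_0^n$, $1\le j\le p$, $1\le\ell\le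 q$) by writing $\partial^iA^j_\ell$ in normally ordered form $\sum a_{\alpha k}x^\alpha\partial^k$ and setting $x=0$, so that the result is $\sum_k a^{ij}_{k\ell}\partial^k$. The linear map $\cdot\bar A^T:(K^{n\infty})^q[\mathbf t]\to(K^{n\infty})^p[\mathbf s]$ sends the row vector $(c_{k\ell})$ to the row vector whose $(i,j)$ entry is $\sum_{k,\ell}a^{ij}_{k\ell}c_{k\ell}$; under $\sigma$ it is the map $\hat{\mathcal O}^q\to\hat{\mathcal O}^p$, $f\mapsto A\bullet f$. The map $\cdot\bar B^T:(K^{n\infty})^r[\mathbf u]\to(K^{n\infty})^q[\mathbf t]$ is defined in the same way from the $q\times r$ matrix $B$. These matrices are block upper triangular with respect to degree, so restricting to indices of degree $\le m$ gives, for each $m$, a complex of finite-dimensional spaces $$(K^{n\infty})^r[\mathbf u]_{\le m}\xrightarrow{\cdot\tau_m(\bar B^T)}(K^{n\infty})^q[\mathbf t]_{\le m}\xrightarrow{\cdot\tau_m(\bar A^T)}(K^{n\infty})^p[\mathbf s]_{\le m},$$ where $\tau_m(\cdot)$ is the submatrix with row and column indices of degree $\le m$. The truncation $\tau_{m',m}:(K^{n\infty})^q[\mathbf t]_{\le m'}\to(K^{n\infty})^q[\mathbf t]_{\le m}$ forgets the entries of degree $>m$.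
   Formalization: Added hypothesis: every root of the b-function of the form w·k+z (k in N_0^n, z integer) is at most k_1; automatic for integral weights, but for real weights the claim can fail, e.g. n=1, w=1/2, I=Dx^2∂^2, m=0, m'=1. *)

(* Defs.v *)
From HB Require Import structures.
From mathcomp Require Import all_boot all_order all_algebra.
From mathcomp Require Import finmap boolp functions reals complex.
From mathcomp.multinomials Require Import monalg.

Set Implicit Arguments.
Unset Strict Implicit.
Unset Printing Implicit Defensive.

Import Order.TTheory GRing.Theory Num.Theory.

Local Open Scope ring_scope.
Local Open Scope complex_scope.

Notation expo n := {ffun 'I_n -> nat}.

Definition expoU n (i : 'I_n) : expo n := [ffun j => (j == i : nat)].

(* An operator is stored in normally ordered form: [P@_(a, b)] is the
   coefficient of x^a d^b and [<< (a, b) >>] is x^a d^b. *)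
Definition weyl (n : nat) (K : comNzRingType) := {malg K[(expo n * expo n)%type]}.

HB.instance Definition _ n K := GRing.Lmodule.on (weyl n K).

Section WeylRing.
Variables (n : nat) (K : comNzRingType).
Local Notation D := (weyl n K).
Local Notation mon := (expo n * expo n)%type.
Implicit Types (P Q S : D) (a b : expo n) (i j : 'I_n) (u v : mon).

Definition wmon u : D := << u >>.

Definition linext (f : mon -> D) P : D := \sum_(u <- msupp P) P@_u *: f u.

Definition expo_pred a i : expo n := [ffun j => (a j - (j == i))%N].

Lemma expo_predDr a b i : (0 < b i)%N ->
  expo_pred (a + b) i = a + expo_pred b i.
Proof.
move=> bi; apply/ffunP => j; rewrite !ffunE -!/(addn _ _).
by case: eqP => [->|_]; rewrite ?subn0 // -addnBA.
Qed.

Lemma expo_predDl a b i : (0 < a i)%N ->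
  expo_pred (a + b) i = expo_pred a i + b.
Proof. by move=> ai; rewrite addrC expo_predDr // addrC. Qed.

(* Left multiplication by x^a on normally ordered operators. *)
Definition Xmul a : D -> D := linext (fun u => wmon (a + u.1, u.2)).

(* Left multiplication by d_i: d_i x^a = x^a d_i + a_i x^(a - e_i). *)
Definition Dmul1 i : D -> D :=
  linext (fun u => wmon (u.1, u.2 + expoU i)
                   + (u.1 i)%:R *: wmon (expo_pred u.1 i, u.2)).

Definition Dmuls (s : seq 'I_n) b Q : D :=
  foldr (fun i => iter (b i) (Dmul1 i)) Q s.

Definition Dmul b : D -> D := Dmuls (enum 'I_n) b.

Definition wmul P Q : D := linext (fun u => Xmul u.1 (Dmul u.2 Q)) P.

Lemma linextEw (f : mon -> D) P (d : {fset mon}) :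
  (msupp P `<=` d)%fset -> linext f P = \sum_(u <- d) P@_u *: f u.
Proof.
move=> le; rewrite /linext (big_fset_incl _ le) // => u _ uP.
by rewrite (mcoeff_outdom uP) scale0r.
Qed.

Lemma linext_is_linear (f : mon -> D) : linear (linext f).
Proof.
move=> c P Q.
set d := (msupp P `|` msupp Q `|` msupp (c *: P + Q))%fset.
rewrite (@linextEw f P d) ?(@linextEw f Q d) ?(@linextEw f (c *: P + Q) d).
- rewrite scaler_sumr -big_split /=; apply: eq_bigr => u _.
  by rewrite mcoeffD mcoeffZ scalerDl scalerA.
- exact: fsubsetUr.
- by rewrite /d -fsetUA fsetUCA fsubsetUl.
- by rewrite /d -fsetUA fsubsetUl.
Qed.

HB.instance Definition _ f :=
  GRing.isLinear.Build K D D *:%R (linext f) (linext_is_linear f).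

Lemma linext_mon f u : linext f (wmon u) = f u.
Proof.
by rewrite /linext /wmon msuppU oner_eq0 big_seq_fset1 mcoeffUU scale1r.
Qed.

Lemma eq_lin_mon (f g : {linear D -> D}) :
  (forall u, f (wmon u) = g (wmon u)) -> f =1 g.
Proof.
move=> fg P; have -> : P = \sum_(u <- msupp P) P@_u *: wmon u.
  rewrite {1}[P]monalgE; apply: eq_bigr => u _.
  by apply/malgP => v; rewrite mcoeffZ !mcoeffU mulr_natr.
by rewrite !linear_sum; apply: eq_bigr => u _; rewrite !linearZ /= fg.
Qed.

HB.instance Definition _ a := GRing.Linear.on (Xmul a).
HB.instance Definition _ i := GRing.Linear.on (Dmul1 i).

Lemma Dmuls_is_linear s b : linear (Dmuls s b).
Proof.
elim: s => [|i s IHs] c P Q //=; rewrite IHs.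
by elim: (b i) => [|k IHk] //=; rewrite IHk linearP.
Qed.
HB.instance Definition _ s b :=
  GRing.isLinear.Build K D D *:%R (Dmuls s b) (Dmuls_is_linear s b).
HB.instance Definition _ b := GRing.Linear.on (Dmul b).

Definition wmulr Q P : D := wmul P Q.
HB.instance Definition _ Q := GRing.Linear.copy (wmulr Q)
  (linext (fun u => Xmul u.1 (Dmul u.2 Q))).

Lemma wmulrE Q P : wmulr Q P = wmul P Q.
Proof. by []. Qed.

Lemma wmul_is_linear P : linear (wmul P).
Proof.
move=> c Q S; rewrite /wmul /linext scaler_sumr -big_split /=.
apply: eq_bigr => u _.
by rewrite !linearP /= scalerA mulrC -scalerA.
Qed.
HB.instance Definition _ P :=
  GRing.isLinear.Build K D D *:%R (wmul P) (wmul_is_linear P).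

Lemma wmon_eq1 a a' b : a = a' -> wmon (a, b) = wmon (a', b).
Proof. by move=> ->. Qed.

Lemma wmon_eq2 a b b' : b = b' -> wmon (a, b) = wmon (a, b').
Proof. by move=> ->. Qed.

Lemma wone_neq0 : wmon (0, 0) != 0.
Proof. by rewrite /wmon monalgU_eq0 oner_eq0. Qed.

Local Opaque wmon expo_pred expoU linext Xmul Dmul1.

Lemma Xmul_mon a u : Xmul a (wmon u) = wmon (a + u.1, u.2).
Proof. exact: linext_mon. Qed.

Lemma Dmul1_mon i u : Dmul1 i (wmon u) =
  wmon (u.1, u.2 + expoU i) + (u.1 i)%:R *: wmon (expo_pred u.1 i, u.2).
Proof. exact: linext_mon. Qed.

Lemma Dmul1DZ i (c : K) P Q :
  Dmul1 i (P + c *: Q) = Dmul1 i P + c *: Dmul1 i Q.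
Proof. by rewrite linearD linearZ. Qed.

Lemma wmul_mon u P : wmul (wmon u) P = Xmul u.1 (Dmul u.2 P).
Proof. exact: linext_mon. Qed.

Lemma Xmul0 P : Xmul 0 P = P.
Proof.
apply: (eq_lin_mon (f := Xmul 0) (g := idfun)) => u.
by rewrite /= Xmul_mon add0r -surjective_pairing.
Qed.

Lemma XmulD a b P : Xmul (a + b) P = Xmul a (Xmul b P).
Proof.
apply: (eq_lin_mon (f := Xmul (a + b)) (g := Xmul a \o Xmul b)) => u.
by rewrite /= !Xmul_mon addrA.
Qed.

Lemma Dmul1_Xmul i a P : Dmul1 i (Xmul a P) =
  Xmul a (Dmul1 i P) + (a i)%:R *: Xmul (expo_pred a i) P.
Proof.
apply: (eq_lin_mon (f := Dmul1 i \o Xmul a)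
  (g := (Xmul a \o Dmul1 i) \+ ((a i)%:R \*: Xmul (expo_pred a i)))) => u /=.
rewrite !Xmul_mon !Dmul1_mon /= linearD linearZ /= !Xmul_mon /= -addrA.
have e1 : (u.1 i)%:R *: wmon (expo_pred (a + u.1) i, u.2)
        = (u.1 i)%:R *: wmon (a + expo_pred u.1 i, u.2).
  case: (posnP (u.1 i)) => [ui|ui]; first by rewrite ui 2!scale0r.
  exact: (congr1 (fun e => _ *: wmon (e, u.2)) (expo_predDr a ui)).
have e2 : (a i)%:R *: wmon (expo_pred (a + u.1) i, u.2)
        = (a i)%:R *: wmon (expo_pred a i + u.1, u.2).
  case: (posnP (a i)) => [ai|ai]; first by rewrite ai 2!scale0r.
  exact: (congr1 (fun e => _ *: wmon (e, u.2)) (expo_predDl u.1 ai)).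
by rewrite ffunE natrD scalerDl e1 e2 [X in _ + X = _]addrC.
Qed.

Lemma scale_exchange (V : lmodType K) (x y : K) (p q r s : V) :
  (p + x *: q) + y *: (r + x *: s) = (p + y *: r) + x *: (q + y *: s).
Proof.
by rewrite !scalerDr !scalerA [y * x]mulrC -!addrA; congr (_ + _); rewrite addrCA.
Qed.

Lemma Dmul1C i j P : Dmul1 i (Dmul1 j P) = Dmul1 j (Dmul1 i P).
Proof.
apply: (eq_lin_mon (f := Dmul1 i \o Dmul1 j) (g := Dmul1 j \o Dmul1 i)) => u /=.
case: (eqVneq i j) => [-> //|ij].
rewrite [Dmul1 j (wmon u)]Dmul1_mon [Dmul1 i (wmon u)]Dmul1_mon !Dmul1DZ.
rewrite !Dmul1_mon /=.
have -> : expo_pred u.1 j i = u.1 i by rewrite ffunE (negPf ij) subn0.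
have -> : expo_pred u.1 i j = u.1 j by rewrite ffunE eq_sym (negPf ij) subn0.
have -> : expo_pred (expo_pred u.1 j) i = expo_pred (expo_pred u.1 i) j.
  by apply/ffunP => k; rewrite !ffunE subnAC.
have -> : u.2 + expoU j + expoU i = u.2 + expoU i + expoU j by rewrite addrAC.
exact: scale_exchange.
Qed.

Lemma iter_Dmul1C i j k P :
  iter k (Dmul1 i) (Dmul1 j P) = Dmul1 j (iter k (Dmul1 i) P).
Proof. by elim: k => [|k IHk]; rewrite ?iterS ?IHk; last exact: Dmul1C. Qed.

Lemma DmulsU s b i Q : uniq s ->
  Dmuls s (b + expoU i) Q = if i \in s then Dmul1 i (Dmuls s b Q)
                            else Dmuls s b Q.
Proof.
elim: s => //= j s IHs /andP[js us]; rewrite in_cons !ffunE (IHs us).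
case: (eqVneq i j) js => [-> /negPf-> /=|ij _ /=].
  by rewrite -[(b j + _)%R]/(b j + 1)%N addn1.
have -> : (b j + 0%N)%R = b j by exact: addr0.
by case: ifP => // _; exact: iter_Dmul1C.
Qed.

Lemma DmulU b i Q : Dmul (b + expoU i) Q = Dmul1 i (Dmul b Q).
Proof. by rewrite /Dmul DmulsU ?enum_uniq // mem_enum. Qed.

Lemma Dmul0 Q : Dmul 0 Q = Q.
Proof. by rewrite /Dmul; elim: (enum _) => //= i s; rewrite ffunE /=. Qed.

Lemma Dmul_mon0 b c : Dmul b (wmon (0, c)) = wmon (0, c + b).
Proof.
have H s : uniq s -> Dmuls s b (wmon (0, c))
    = wmon (0, [ffun j => c j + (j \in s) * b j]%N).
  elim: s => [|i s IHs] /=.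
    by move=> _; apply: wmon_eq2; apply/ffunP => j; rewrite ffunE addn0.
  case/andP=> iNs us; rewrite IHs //.
  suff -> k : iter k (Dmul1 i) (wmon (0, [ffun j => c j + (j \in s) * b j]%N))
     = wmon (0, [ffun j => c j + (j \in s) * b j + (j == i) * k]%N).
    apply: wmon_eq2; apply/ffunP => j; rewrite !ffunE in_cons.
    by case: eqP => [->|_] /=; rewrite ?(negPf iNs) ?mul0n ?mul1n ?addn0.
  elim: k => [|k IHk] /=.
    by apply: wmon_eq2; apply/ffunP => j; rewrite !ffunE muln0 addn0.
  rewrite IHk Dmul1_mon /= ffunE scale0r addr0; apply: wmon_eq2.
  by apply/ffunP => j; rewrite !ffunE -!/(addn _ _) mulnS [((j == i) + _)%N]addnC addnA.
rewrite /Dmul H ?enum_uniq //; apply: wmon_eq2; apply/ffunP => j.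
by rewrite !ffunE mem_enum mul1n.
Qed.

Lemma wmul_Xmul a P Q : wmul (Xmul a P) Q = Xmul a (wmul P Q).
Proof.
apply: (eq_lin_mon (f := wmulr Q \o Xmul a) (g := Xmul a \o wmulr Q)) => u.
by rewrite /= Xmul_mon !wmulrE !wmul_mon /= XmulD.
Qed.

Lemma wmul_Dmul1 i P Q : wmul (Dmul1 i P) Q = Dmul1 i (wmul P Q).
Proof.
apply: (eq_lin_mon (f := wmulr Q \o Dmul1 i)
  (g := Dmul1 i \o wmulr Q)) => u /=.
rewrite Dmul1_mon linearD linearZ /= !wmulrE !wmul_mon /= DmulU.
by rewrite Dmul1_Xmul.
Qed.

Lemma wmul_Dmul b P Q : wmul (Dmul b P) Q = Dmul b (wmul P Q).
Proof.
rewrite /Dmul; elim: (enum _) => //= i s <-.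
elim: (b i) => [|k IHk]; first reflexivity.
by rewrite 2!iterS wmul_Dmul1 IHk.
Qed.

Lemma wmulA : associative wmul.
Proof.
move=> P Q S; apply: (eq_lin_mon (f := wmulr (wmul Q S))
  (g := wmulr S \o wmulr Q)) => u /=.
by rewrite !wmulrE !wmul_mon wmul_Xmul wmul_Dmul.
Qed.

Lemma wmul1l : left_id (wmon (0, 0)) wmul.
Proof. by move=> P; rewrite wmul_mon Dmul0 Xmul0. Qed.

Lemma wmul1r : right_id (wmon (0, 0)) wmul.
Proof.
move=> P; apply: (eq_lin_mon (f := wmulr (wmon (0, 0))) (g := idfun)) => u.
by rewrite /= wmulrE wmul_mon Dmul_mon0 Xmul_mon addr0 add0r -surjective_pairing.
Qed.

Lemma wmulDl : left_distributive wmul +%R.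
Proof. by move=> P Q S; exact: (linearD (wmulr S)). Qed.

Lemma wmulDr : right_distributive wmul +%R.
Proof. by move=> P Q S; exact: linearD. Qed.

HB.instance Definition _ := GRing.Zmodule_isNzRing.Build (weyl n K)
  wmulA wmul1l wmul1r wmulDl wmulDr wone_neq0.

Lemma wscaleAl (c : K) P Q : c *: (P * Q) = (c *: P) * Q.
Proof. by rewrite -[RHS]/(wmulr Q (c *: P)) linearZ. Qed.
HB.instance Definition _ := GRing.Lmodule_isLalgebra.Build K (weyl n K) wscaleAl.

Lemma wscaleAr (c : K) P Q : c *: (P * Q) = P * (c *: Q).
Proof. by rewrite -[RHS]/(wmul P (c *: Q)) linearZ. Qed.
HB.instance Definition _ := GRing.Lalgebra_isAlgebra.Build K (weyl n K) wscaleAr.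

Definition wx i : D := wmon (expoU i, 0).
Definition wd i : D := wmon (0, expoU i).
Definition wdmon b : D := wmon (0, b).

Lemma wmonE a b : wmon (a, b) =
  (\prod_(i <- enum 'I_n) wx i ^+ a i) * (\prod_(i <- enum 'I_n) wd i ^+ b i).
Proof.
have wxM c P : wmon (c, 0) * P = Xmul c P.
  by rewrite -[LHS]/(wmul _ _) wmul_mon Dmul0.
have wdM i P : wd i * P = Dmul1 i P.
  by rewrite -[LHS]/(wmul _ _) wmul_mon Xmul0 -[expoU i]add0r DmulU Dmul0.
have wxX i k : wx i ^+ k = wmon ([ffun j => (j == i) * k]%N, 0).
  elim: k => [|k IHk].
    by apply: wmon_eq1; apply/ffunP => j; rewrite !ffunE muln0.
  rewrite exprS IHk wxM Xmul_mon; apply: wmon_eq1.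
  by apply/ffunP => j; rewrite !ffunE mulnS.
have -> : \prod_(i <- enum 'I_n) wx i ^+ a i = wmon (a, 0).
  suff H s : uniq s -> \prod_(i <- s) wx i ^+ a i
      = wmon ([ffun j => (j \in s) * a j]%N, 0).
    rewrite H ?enum_uniq //; apply: wmon_eq1; apply/ffunP => j.
    by rewrite ffunE mem_enum mul1n.
  elim: s => [|i s IHs] /=.
    by rewrite big_nil => _; apply: wmon_eq1; apply/ffunP => j; rewrite !ffunE.
  case/andP=> iNs us; rewrite big_cons IHs // wxX wxM Xmul_mon.
  apply: wmon_eq1; apply/ffunP => j; rewrite !ffunE in_cons.
  rewrite -[LHS]/(addn _ _).
  by case: eqP => [->|_] /=; rewrite ?(negPf iNs) ?mul0n ?mul1n ?addn0.
have -> : \prod_(i <- enum 'I_n) wd i ^+ b i = wmon (0, b).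
  rewrite -[b in RHS]add0r -Dmul_mon0 /Dmul; elim: (enum _) => [|i s IHs] /=.
    by rewrite big_nil.
  rewrite big_cons IHs; elim: (b i) => [|k IHk] /=; first by rewrite expr0 mul1r.
  by rewrite exprS -mulrA IHk wdM.
by rewrite wxM Xmul_mon addr0.
Qed.

Lemma wx_comm i j : wx i * wx j = wx j * wx i.
Proof.
rewrite -![_ * _]/(wmul _ _) !wmul_mon /= !Dmul0 !Xmul_mon /=.
by rewrite [expoU i + _]addrC.
Qed.

Lemma wd_comm i j : wd i * wd j = wd j * wd i.
Proof.
rewrite -![_ * _]/(wmul _ _) !wmul_mon /= !Xmul0 !Dmul_mon0.
by rewrite [expoU i + _]addrC.
Qed.

Lemma wd_wx i j : wd i * wx j = wx j * wd i + (i == j)%:R.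
Proof.
rewrite -![_ * _]/(wmul _ _) !wmul_mon /= Xmul0 Dmul0 -[expoU i]add0r DmulU Dmul0.
rewrite Dmul1_mon Xmul_mon /= !addr0 !add0r ffunE; congr (_ + _).
case: (eqVneq i j) => [->|]; last by rewrite scale0r.
by rewrite scale1r; apply: wmon_eq1; apply/ffunP => k; rewrite !ffunE subnn.
Qed.

End WeylRing.

Arguments wmon {n K} u.
Arguments wx {n K} i.
Arguments wd {n K} i.
Arguments wdmon {n K} b.

Section Modules.
Variable (D : nzRingType).

Definition is_submod (V : lmodType D) (N : V -> Prop) : Prop :=
  [/\ N 0, forall u v, N u -> N v -> N (u + v) & forall (a : D) u, N u -> N (a *: u)].

Definition submod_gen (V : lmodType D) (S : V -> Prop) : V -> Prop :=
  fun v => forall N, is_submod N -> (forall s, S s -> N s) -> N v.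

Definition is_left_ideal (I : D -> Prop) : Prop :=
  [/\ I 0, forall u v, I u -> I v -> I (u + v) & forall a u, I u -> I (a * u)].

End Modules.

(* dim_K (V / (V :&: U)) = N, for K-linear subspaces V and U of W. *)
Definition quot_dim (K : fieldType) (W : lmodType K) (V U : W -> Prop) (N : nat)
    : Prop :=
  exists2 e : 'I_N -> W, forall i, V (e i) &
    forall v, V v -> exists! c : 'rV[K]_N, U (v - \sum_i c 0 i *: e i).

Section Holonomic.
Variables (n : nat) (K : fieldType).

Definition bernstein_filt (k : nat) (P : weyl n K) : Prop :=
  forall u, u \in msupp P -> (\sum_i u.1 i + \sum_i u.2 i <= k)%N.

(* D/I = 0 or its Hilbert polynomial for the Bernstein filtration has degree n. *)
Definition holonomic (I : weyl n K -> Prop) : Prop :=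
  I 1 \/ exists2 h : {poly rat}, size h = n.+1 &
    exists k0 : nat, forall k, (k0 <= k)%N ->
      exists2 N : nat, quot_dim (bernstein_filt k) I N & N%:R = h.[k%:R].

End Holonomic.

(* [rk b i.+1] is the rank b_i of the i-th free module: b_{-1} = 0, b_0 = 1 and
   b_1, b_2, ... are the values of [b].  Accordingly [psi i] below is the matrix
   psi_i of D^(b_i) -> D^(b_(i-1)), psi_0 has no columns, and [sh i.+1] is the
   shift vector m_i. *)
Definition rk (b : nat -> nat) (i : nat) : nat :=
  match i with 0 => 0 | 1 => 1 | j.+2 => b j end.

Section Orders.
Variables (R : realType) (n : nat) (w : 'I_n -> R).
Local Notation K := R[i].
Local Notation D := (weyl n K).

Definition tdeg q (t : 'I_q -> int) (u : expo n * expo n) (j : 'I_q) : R :=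
  \sum_i w i * ((u.2 i)%:R - (u.1 i)%:R) + (t j)%:~R.

Definition is_ord q (t : 'I_q -> int) (P : 'rV[D]_q) (d : R) : Prop :=
  (exists j u, u \in msupp (P 0 j) /\ tdeg t u j = d) /\
  (forall j u, u \in msupp (P 0 j) -> tdeg t u j <= d).

Definition init q (t : 'I_q -> int) (P : 'rV[D]_q) : 'rV[D]_q :=
  \row_j \sum_(u <- msupp (P 0 j) |
      [forall j', all (fun u' => tdeg t u' j' <= tdeg t u j) (msupp (P 0 j'))])
    (P 0 j)@_u *: wmon u.

Definition init_submod q (t : 'I_q -> int) (N : 'rV[D]_q -> Prop)
    : 'rV[D]_q -> Prop :=
  submod_gen (fun S => exists2 P, N P & S = init t P).

Definition init_ideal (I : D -> Prop) (P : D) : Prop :=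
  init_submod (fun _ : 'I_1 => 0) (fun Q => I (Q 0 0)) (const_mx P).

Definition out_ker (I : D -> Prop) b (psi : forall i, 'M[D]_(rk b i.+1, rk b i))
    (i : nat) : 'rV[D]_(rk b i.+1) -> Prop :=
  match i with
  | 0 => fun Q : 'rV[D]_1 => I (Q 0 0)
  | j.+1 => fun Q => Q *m psi j.+1 = 0
  end.

Record adapted_resolution (I : D -> Prop) (b : nat -> nat)
    (psi : forall i, 'M[D]_(rk b i.+1, rk b i))
    (sh : forall i, 'I_(rk b i) -> int) : Prop := {
  adapted_shift0 : forall j, sh 1%N j = 0;
  adapted_shift : forall i j, row j (psi i) != 0 ->
    is_ord (@sh i) (row j (psi i)) (sh i.+1 j)%:~R;
  adapted_ker : forall i Q, out_ker I psi Q <->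
    submod_gen (fun S => exists j, S = row j (psi i.+1)) Q;
  adapted_init : forall i Q, init_submod (@sh i.+1) (@out_ker I b psi i) Q <->
    submod_gen (fun S => exists j, S = init (@sh i.+1) (row j (psi i.+1))) Q
}.

Definition euler : D := \sum_i (w i)%:C *: (wx i * wd i).

Definition is_bfunction (I : D -> Prop) (bf : {poly K}) : Prop :=
  bf \is monic /\
  forall p : {poly K}, init_ideal I (horner_alg euler p) <-> (bf %| p)%R.

Definition is_max_integral_root (bf : {poly K}) (k1 : int) : Prop :=
  root bf k1%:~R /\ forall k : int, root bf k%:~R -> k <= k1.

Definition wdot (k : expo n) : R := \sum_i w i * (k i)%:R.

(* For a non-integral weight the degrees w.k + t_l of the indices (k, l) need
   not be integers, and the roots of the b-function that are degrees are the
   ones that matter, integral or not: for n = 1, w = 1/2 and I = D x^2 d^2, the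
   b-function is s(s - 1/2), while the solution x of degree 1/2 is lost by
   truncation from degree 1 to degree 0.  For integral weights the condition
   below is part of the maximality of k1, see [degree_roots_le_int]. *)
Definition degree_roots_le (bf : {poly K}) (k1 : int) : Prop :=
  forall (k : expo n) (z : int),
    root bf (wdot k + z%:~R)%:C -> wdot k + z%:~R <= k1%:~R.

Lemma degree_roots_le_int (bf : {poly K}) (k1 : int) (wz : 'I_n -> int) :
  (forall i, w i = (wz i)%:~R) ->
  is_max_integral_root bf k1 -> degree_roots_le bf k1.
Proof.
move=> wE [_ maxk1] k z.
have -> : wdot k + z%:~R = (\sum_i wz i * (k i)%:Z + z)%:~R.
  rewrite rmorphD rmorph_sum; congr (_ + _); apply: eq_bigr => i _.
  by rewrite wE rmorphM.
by rewrite rmorph_int ler_int; exact: maxk1.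
Qed.

(* (K^(n oo))^q: the coordinates c_{kl} are those of the power series
   \sum_{k,l} c_{kl} / k! x^k e_l. *)
Definition kvec (q : nat) : Type := (expo n * 'I_q) -> K^o.
HB.instance Definition _ q := GRing.Lmodule.on (kvec q).

Definition ideg q (t : 'I_q -> int) (x : expo n * 'I_q) : R :=
  wdot x.1 + (t x.2)%:~R.

Definition kvec_le q (t : 'I_q -> int) (m : int) (c : kvec q) : Prop :=
  forall x, m%:~R < ideg t x -> c x = 0.

Definition trunc q (t : 'I_q -> int) (m : int) (c : kvec q) : kvec q :=
  fun x => if ideg t x <= m%:~R then c x else 0.

(* The entry a^{ij}_{kl}, with x = (i, j) and y = (k, l). *)
Definition bar_entry p q (A : 'M[D]_(p, q))
    (x : expo n * 'I_p) (y : expo n * 'I_q) : K :=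
  (wdmon x.1 * A x.2 y.2)@_(0, y.1).

(* For given x and l, only the k with (0, k) in the support contribute. *)
Definition bar_map p q (A : 'M[D]_(p, q)) (c : kvec q) : kvec p :=
  fun x => \sum_l \sum_(u <- msupp (wdmon x.1 * A x.2 l) | u.1 == 0)
             bar_entry A x (u.2, l) * c (u.2, l).

Definition tau_map p q (s : 'I_p -> int) (t : 'I_q -> int) (m : int)
    (A : 'M[D]_(p, q)) (c : kvec q) : kvec p :=
  trunc s m (bar_map A (trunc t m c)).

Definition tau_ker p q (s : 'I_p -> int) (t : 'I_q -> int) (m : int)
    (A : 'M[D]_(p, q)) (c : kvec q) : Prop :=
  kvec_le t m c /\ tau_map s t m A c = 0.

Definition tau_im q r (t : 'I_q -> int) (u : 'I_r -> int) (m : int)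
    (B : 'M[D]_(q, r)) (c : kvec q) : Prop :=
  exists2 e, kvec_le u m e & c = tau_map t u m B e.

End Orders.

(* f induces an isomorphism Z / B -> Z' / B' of vector spaces. *)
Definition induces_iso (K : fieldType) (U V : lmodType K)
    (Z B : U -> Prop) (Z' B' : V -> Prop) (f : U -> V) : Prop :=
  [/\ is_submod Z /\ is_submod B, is_submod Z' /\ is_submod B',
      (forall c, B c -> Z c) /\ (forall c, B' c -> Z' c), linear f &
   [/\ forall c, Z c -> Z' (f c),
      forall c, B c -> B' (f c),
      forall c, Z c -> B' (f c) -> B c &
      forall c', Z' c' -> exists2 c, Z c & B' (c' - f c)]].

(* Main.v *)
Require Import Defs.
From HB Require Import structures.
From mathcomp Require Import all_boot all_order all_algebra.
From mathcomp Require Import finmap boolp reals complex.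
From mathcomp.multinomials Require Import monalg.
From mathcomp Require Import zify ring.

Set Implicit Arguments.
Unset Strict Implicit.
Unset Printing Implicit Defensive.

Import Order.TTheory GRing.Theory Num.Theory.
Local Open Scope ring_scope.

(** The truncations form a tower of quotients of the complex [Hom(F, O)], for the
    resolution [F] and the ring [O] of formal power series, filtered by degree.
    Passing from [m'] to [m] kills the subcomplex of vectors with entries in
    degrees above [m] only, so the map in cohomology is bijective as soon as this
    subcomplex has no cohomology in degrees up to [m'] ([acyclicity]):
    injectivity uses this at the given place of the complex and surjectivity at
    the next one.

    The reason for acyclicity is the Euler operator [theta], the sum of the
    [w_i x_i d_i].  It acts on the monomial [x^k] as the scalar [w . k], and right
    multiplication by [b(theta)], suitably shifted on each free module, is
    compatible with the homogeneous parts of the maps of [F].  On the degree-zero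
    module the operator [b(theta)] lies in the initial ideal, by definition of
    the [b]-function.  As with any map that vanishes on the module being
    resolved, it is therefore null-homotopic on the whole resolution; here this
    holds up to terms of lower order ([homotopy]).  Dually, on vectors
    starting in degree [e] the scalar [b(e)] is homotopic to zero in the lowest
    degree.  For [e > m >= k1] this scalar is nonzero, so a cocycle can be
    corrected by a coboundary to start in a higher degree, and as the weights are
    positive only finitely many degrees occur up to [m'] ([acyclicity]).

    Constructing the homotopy with controlled orders needs the resolution to be
    strict: an element of order at most [e] in the image of a map must be the
    image of an element of order at most [e] ([strictness]).  By definition of an
    adapted resolution, a leading form can always be cancelled, but as
    orders are unbounded below (and, for real weights, not even discrete)
    repeated cancellation need not end.  It is brought to an end by the existence
    of finite standard bases for the order filtration ([standard_basis]), which
    is proved as in the homogenized Weyl algebra, by means of Dickson's lemma.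

    All statements about orders are made for matrices over the Weyl algebra with
    shifts on both sides ([mfil]), so that maps of filtered modules compose as
    matrices and their orders add up ([mfilM]). *)

(** * Monomials in products of differential operators *)

Section Support.
Variables (n : nat) (K : comNzRingType).
Local Notation D := (weyl n K).
Local Notation mon := (expo n * expo n)%type.
Implicit Types (P Q : D) (u v : mon) (S T : mon -> Prop).

Lemma mcoeff_wmon u v : (wmon u : D)@_v = (u == v)%:R.
Proof. by rewrite /wmon mcoeffU. Qed.

Lemma wcoeff0 u : (0 : D)@_u = 0.
Proof. exact: mcoeff0. Qed.

Lemma wcoeffD P Q u : (P + Q)@_u = P@_u + Q@_u.
Proof. exact: mcoeffD. Qed.

Lemma wcoeffN P u : (- P)@_u = - P@_u.
Proof. exact: mcoeffN. Qed.

Lemma wcoeffB P Q u : (P - Q)@_u = P@_u - Q@_u.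
Proof. exact: mcoeffB. Qed.

Lemma wcoeffZ c P u : (c *: P)@_u = c * P@_u.
Proof. exact: mcoeffZ. Qed.

Lemma weylP P Q : (forall u, P@_u = Q@_u) -> P = Q.
Proof. by move/malgP. Qed.

Lemma weylE P : P = \sum_(u <- msupp P) P@_u *: wmon u.
Proof.
rewrite {1}[P]monalgE; apply: eq_bigr => u _; apply: weylP => v.
rewrite wcoeffZ; apply: etrans (mcoeffU _ _ _) _.
by rewrite -mulr_natr -(mcoeff_wmon u v).
Qed.

Definition supp_in S P := forall u, P@_u != 0 -> S u.

Lemma supp_sub S T P : (forall u, S u -> T u) -> supp_in S P -> supp_in T P.
Proof. by move=> ST SP u /SP/ST. Qed.

Lemma supp0 S : supp_in S 0.
Proof. by move=> u; rewrite wcoeff0 eqxx. Qed.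

Lemma suppD S P Q : supp_in S P -> supp_in S Q -> supp_in S (P + Q).
Proof.
move=> SP SQ u; rewrite wcoeffD.
have [P0|/SP//] := eqVneq P@_u 0; rewrite P0 add0r; exact: SQ.
Qed.

Lemma suppN S P : supp_in S P -> supp_in S (- P).
Proof. by move=> SP u; rewrite wcoeffN oppr_eq0 => /SP. Qed.

Lemma suppB S P Q : supp_in S P -> supp_in S Q -> supp_in S (P - Q).
Proof. by move=> SP SQ; apply: suppD => //; apply: suppN. Qed.

Lemma suppZ S c P : supp_in S P -> supp_in S (c *: P).
Proof.
move=> SP u; rewrite wcoeffZ => h; apply: SP; apply: contraNneq h => ->.
by rewrite mulr0.
Qed.

Lemma supp_sum S (I : eqType) (r : seq I) (X : pred I) (F : I -> D) :
  (forall i, i \in r -> X i -> supp_in S (F i)) -> supp_in S (\sum_(i <- r | X i) F i).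
Proof.
move=> SF; rewrite big_seq_cond; apply: big_ind; [exact: supp0|exact: suppD|].
by move=> i /andP[? ?]; apply: SF.
Qed.

Lemma supp_wmon S u : S u -> supp_in S (wmon u).
Proof. by move=> Su v; rewrite mcoeff_wmon; have [<-|] := eqVneq u v; rewrite ?eqxx //. Qed.

Lemma supp_lin S T (f : {linear D -> D}) P :
  (forall u, S u -> supp_in T (f (wmon u))) -> supp_in S P -> supp_in T (f P).
Proof.
move=> fS SP; rewrite [P]weylE linear_sum; apply: supp_sum => u.
rewrite -mcoeff_neq0 => /SP Su _; rewrite linearZ; apply: suppZ; exact: fS.
Qed.

Lemma supp_mul S T (V : mon -> Prop) P Q :
  (forall u v, S u -> T v -> supp_in V (wmon u * wmon v)) ->
  supp_in S P -> supp_in T Q -> supp_in V (P * Q).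
Proof.
move=> H SP TQ.
apply: (supp_lin (f := @wmulr n K Q) (S := S)) => //= u Su.
apply: (supp_lin (f := @wmul n K (wmon u)) (S := T)) => //= v Tv.
exact: H.
Qed.

Lemma expoDE (a b : expo n) i : (a + b) i = (a i + b i)%N.
Proof. by rewrite ffunE. Qed.

Lemma expoUE (i j : 'I_n) : expoU i j = (j == i) :> nat.
Proof. by rewrite ffunE. Qed.

Lemma expo_predE (a : expo n) i j : expo_pred a i j = (a j - (j == i))%N.
Proof. by rewrite ffunE. Qed.

Lemma expo_predK (a : expo n) i : (0 < a i)%N -> expo_pred a i + expoU i = a.
Proof.
move=> ai; apply/ffunP => j; rewrite expoDE expoUE expo_predE.
by have [->|_] := eqVneq j i; rewrite ?subn0 ?addn0 // subnK.
Qed.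

Lemma expo_ind (X : expo n -> Prop) :
  X 0 -> (forall b i, X b -> X (b + expoU i)) -> forall b, X b.
Proof.
move=> X0 XS b; have [k] := ubnP (\sum_i b i)%N; elim: k b => // k IH b.
have [|[i bi]] : (forall i, b i = 0%N) \/ exists i, (0 < b i)%N.
  have [/forallP h|/forallPn h] := boolP [forall i, b i == 0%N].
    by left => i; apply/eqP.
  by right; case: h => i; rewrite -lt0n; exists i.
  by move=> b0 _; have -> : b = 0 by apply/ffunP => i; rewrite b0 ffunE.
rewrite -(expo_predK bi) => lt; apply/XS/IH; move: lt.
under eq_bigr do rewrite expoDE; rewrite big_split /= ltnS; apply: leq_trans.
rewrite -addn1 leq_add2l (bigD1 i) //= expoUE eqxx leq_addr //.
Qed.

Lemma wmonM u v : wmon u * wmon v = Xmul u.1 (Dmul u.2 (wmon v)) :> D.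
Proof. by rewrite -[LHS]/(wmul _ _) wmul_mon. Qed.

End Support.

Section Weight.
Variables (R : realType) (n : nat) (w : 'I_n -> R) (K : comNzRingType).
Local Notation D := (weyl n K).
Local Notation mon := (expo n * expo n)%type.
Implicit Types (P Q : D) (u v : mon).

(** The order of the monomial [u] for the weight [(-w, w)]. *)
Definition wt u : R := \sum_i w i * ((u.2 i)%:R - (u.1 i)%:R).

Definition tdg u : nat := (\sum_i u.1 i + \sum_i u.2 i)%N.

Lemma wtD u v : wt (u + v) = wt u + wt v.
Proof.
rewrite /wt -big_split; apply: eq_bigr => i _ /=.
by rewrite !expoDE !natrD -mulrDr opprD addrACA.
Qed.

Lemma tdgD u v : tdg (u + v) = (tdg u + tdg v)%N.
Proof.
rewrite /tdg; under eq_bigr do rewrite expoDE; rewrite big_split /=.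
under [in X in (_ + X)%N]eq_bigr do rewrite expoDE; rewrite big_split /=.
by rewrite addnACA.
Qed.

Lemma wtE (a b : expo n) : wt (a, b) = wt (a, 0) + wt (0, b).
Proof. by rewrite -wtD; congr wt; congr (_, _); rewrite ?addr0 ?add0r. Qed.

Lemma tdgE (a b : expo n) : tdg (a, b) = (tdg (a, 0%R) + tdg (0%R, b))%N.
Proof. by rewrite -tdgD; congr tdg; congr (_, _); rewrite ?addr0 ?add0r. Qed.

Lemma wt_d i : wt (0, expoU i) = w i.
Proof.
rewrite /wt (bigD1 i) //= big1 => [|j ji].
  by rewrite expoUE eqxx ffunE subr0 mulr1 addr0.
by rewrite expoUE (negPf ji) ffunE subr0 mulr0.
Qed.

Lemma wt_x i : wt (expoU i, 0) = - w i.
Proof.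
rewrite /wt (bigD1 i) //= big1 => [|j ji].
  by rewrite expoUE eqxx ffunE sub0r mulrN1 addr0.
by rewrite expoUE (negPf ji) ffunE subr0 mulr0.
Qed.

Lemma tdg_d i : tdg (0, expoU i) = 1%N.
Proof.
rewrite /tdg /= big1 ?add0n => [|j _]; last by rewrite ffunE.
by rewrite (bigD1 i) //= big1 => [|j ji]; rewrite ?expoUE ?eqxx // (negPf ji).
Qed.

Lemma tdg_x i : tdg (expoU i, 0) = 1%N.
Proof.
rewrite /tdg /= [X in (_ + X)%N]big1 ?addn0 => [|j _]; last by rewrite ffunE.
by rewrite (bigD1 i) //= big1 => [|j ji]; rewrite ?expoUE ?eqxx // (negPf ji).
Qed.

(** Commuting a derivative past a variable cancels one of each: this keeps the
    weight and lowers the total degree by two. *)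
Lemma wmon_mulE u v :
  supp_in (fun x => wt x = wt u + wt v /\ (tdg x < tdg u + tdg v)%N)
    (wmon u * wmon v - wmon (u + v) : D).
Proof.
pose L a c x := wt x = a /\ (tdg x < c)%N.
have low a b c d (P : D) : a = b -> (c <= d)%N ->
   supp_in (L a c) P -> supp_in (L b d) P.
  by move=> <- cd; apply: supp_sub => x; case=> xa xc; split=> //; exact: leq_trans cd.
have drop (x : mon) i : supp_in (L (wt x + w i) (tdg x))
    ((x.1 i)%:R *: wmon (expo_pred x.1 i, x.2) : D).
  case: (posnP (x.1 i)) => [->|xi]; first by rewrite scale0r; exact: supp0.
  apply: suppZ; apply: supp_wmon; pose y : mon := (expo_pred x.1 i, x.2); rewrite -/y.
  have -> : (x : mon) = y + (expoU i, 0).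
    by case: x xi @y => a b /= ai; congr (_, _); rewrite ?expo_predK // addr0.
  by split; rewrite ?wtD ?wt_x ?addrNK // tdgD tdg_x addn1.
have dstep i a c (P : D) :
    supp_in (L a c) P -> supp_in (L (a + w i) c.+1) (Dmul1 i P).
  apply: (supp_lin (f := Dmul1 i)) => x [xa xc] /=; rewrite Dmul1_mon.
  apply: suppD; last by apply: low (drop x i); rewrite ?xa // ltnW // ltnW.
  apply: supp_wmon; have -> : (x.1, x.2 + expoU i) = x + (0, expoU i).
    by rewrite [x in RHS]surjective_pairing; congr (_, _); rewrite addr0.
  by split; rewrite ?wtD ?wt_d ?xa // tdgD tdg_d addn1.
have H (b : expo n) : supp_in (L (wt (0, b) + wt v) (tdg (0%R, b) + tdg v)%N)
    (Dmul b (wmon v) - wmon (v.1, v.2 + b) : D).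
  elim/expo_ind: b => [|b i IH].
    by rewrite Dmul0 addr0 -surjective_pairing subrr; exact: supp0.
  rewrite DmulU -(subrK (wmon (v.1, v.2 + b)) (Dmul b _)) linearD /=.
  rewrite -addrA; apply: suppD.
    apply: low (dstep i _ _ _ IH).
      have -> : (0, b + expoU i) = (0, b) + (0, expoU i) :> mon.
        by congr (_, _); rewrite addr0.
      by rewrite wtD wt_d addrAC.
    have -> : (0, b + expoU i) = (0, b) + (0, expoU i) :> mon.
      by congr (_, _); rewrite addr0.
    by rewrite tdgD tdg_d addn1 addSn.
  rewrite Dmul1_mon /= addrAC [v.2 + (b + _)]addrA subrr add0r.
  have e : (v.1, v.2 + b) = v + (0, b).
    by rewrite [v in RHS]surjective_pairing; congr (_, _); rewrite addr0.
  have -> : (0, b + expoU i) = (0, b) + (0, expoU i) :> mon.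
    by congr (_, _); rewrite addr0.
  apply: low (drop (v.1, v.2 + b) i); rewrite e.
    by rewrite !wtD wt_d -addrA addrC.
  by rewrite !tdgD tdg_d addn1 addSn addnC.
have -> : wmon u * wmon v - wmon (u + v) =
    Xmul u.1 (Dmul u.2 (wmon v) - wmon (v.1, v.2 + u.2)) :> D.
  by rewrite wmonM linearB /= Xmul_mon; congr (_ - wmon (_, _)); rewrite /= addrC.
apply: (supp_lin (f := Xmul u.1)) (H u.2) => x [xa xc] /=; rewrite Xmul_mon.
apply: supp_wmon; have -> : (u.1 + x.1, x.2) = (u.1, 0) + x.
  by rewrite [x in RHS]surjective_pairing; congr (_, _); rewrite add0r.
rewrite {2 4}[u]surjective_pairing (wtE u.1) (tdgE u.1) wtD tdgD xa addrA.
by split=> //; rewrite -addnA ltn_add2l.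
Qed.

End Weight.

(** * The order filtration on matrices *)

Section Filtration.
Variables (R : realType) (n : nat) (w : 'I_n -> R) (K : comNzRingType).
Local Notation D := (weyl n K).
Local Notation mon := (expo n * expo n)%type.
Local Notation wt := (wt w).

Lemma wmon_mul_wt (u v : mon) :
  supp_in (fun x => wt x = wt u + wt v) (wmon u * wmon v : D).
Proof.
rewrite -(subrK (wmon (u + v)) (wmon u * wmon v)).
apply: suppD; last by apply: supp_wmon; rewrite wtD.
by apply: supp_sub (@wmon_mulE R n w K u v) => x [].
Qed.

(** Right multiplication by [A] maps elements of order at most [d] for the shift [s]
    to elements of order at most [d] for the shift [t]; for [C = false] it
    strictly lowers the order.  A row vector of order at most [d] is the case of one
    row with shift [d]. *)
Definition mfil (C : bool) p q (s : 'I_p -> R) (t : 'I_q -> R) (A : 'M[D]_(p, q)) :=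
  forall i j, supp_in (fun u => wt u + t j < s i ?<= if C) (A i j).

Lemma mfil0 C p q s t : @mfil C p q s t 0.
Proof. by move=> i j; rewrite mxE; exact: supp0. Qed.

Lemma mfilD C p q s t A B : @mfil C p q s t A -> mfil C s t B -> mfil C s t (A + B).
Proof. by move=> FA FB i j; rewrite mxE; exact: suppD. Qed.

Lemma mfilN C p q s t A : @mfil C p q s t A -> mfil C s t (- A).
Proof. by move=> FA i j; rewrite mxE; exact: suppN. Qed.

Lemma mfilB C p q s t A B : @mfil C p q s t A -> mfil C s t B -> mfil C s t (A - B).
Proof. by move=> FA FB; apply: mfilD => //; exact: mfilN. Qed.

Lemma mfilW C p q s t A : @mfil C p q s t A -> mfil true s t A.
Proof. by move=> FA i j; apply: supp_sub (FA i j) => u; exact: lteifW. Qed.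

(** Commutators do not change the order of a monomial ([wmon_mulE]), so orders
    add up in products and the order drops strictly if it does in one factor. *)
Lemma mfilM C1 C2 p q r s t x A B : @mfil C1 p q s t A -> @mfil C2 q r t x B ->
  mfil (C1 && C2) s x (A *m B).
Proof.
move=> FA FB i j; rewrite mxE; apply: supp_sum => k _ _.
apply: supp_mul (FA i k) (FB k j) => u v Su Tv.
apply: supp_sub (@wmon_mul_wt u v) => y ->.
rewrite andbC; apply: lteif_trans Su.
by rewrite -addrA lteifD2l.
Qed.

Lemma mfil_shift C p q s t c A : @mfil C p q s t A ->
  mfil C (fun i => s i + c) (fun j => t j + c) A.
Proof. by move=> FA i j; apply: supp_sub (FA i j) => u; rewrite addrA lteifD2r. Qed.

Lemma mfil_row C p q s t (A : 'M_(p, q)) :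
  mfil C s t A <-> forall i, mfil C (fun _ => s i) t (row i A).
Proof.
split=> FA i j; first by move=> k; rewrite mxE; exact: FA.
by have := FA i 0 j; rewrite mxE.
Qed.

Lemma mfil_le C p q (s s' : 'I_p -> R) t (A : 'M_(p, q)) :
  (forall i, s i <= s' i) -> mfil C s t A -> mfil C s' t A.
Proof.
move=> le FA i j; apply: supp_sub (FA i j) => u us.
by rewrite -[C]andbT; apply: lteif_trans us _; exact: le.
Qed.

End Filtration.

(** * Dickson's lemma and a monomial order *)

Section Dickson.
Local Open Scope nat_scope.

(** Dickson's lemma, by induction on the number of coordinates: with the
    elements found for the other coordinates and a bound [M] for their first one,
    only the elements with first coordinate below [M] are missing, and for each of
    these finitely many values the other coordinates suffice. *)
Lemma dickson_seq (A : eqType) (J : Type) (g : J -> A -> nat) (s : seq J)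
    (L : A -> Prop) :
  exists2 B : seq A, forall a, a \in B -> L a &
    forall a, L a -> exists2 b, b \in B & all (fun j => g j b <= g j a) s.
Proof.
elim: s L => [|j s IH] L.
  have [[a La]|no] := pselect (exists a, L a).
    exists [:: a]; first by move=> b; rewrite inE => /eqP->.
    by move=> b _; exists a; rewrite ?inE.
  by exists [::] => // a La; case: no; exists a.
have [B0 LB0 domB0] := IH L.
have [M ltM] : exists M, forall b, b \in B0 -> g j b <= M.
  exists (\max_(b <- B0) g j b) => b bB; exact: leq_bigmax_seq.
have [B1 LB1 domB1] : exists2 B : seq A, forall a, a \in B -> L a &
    forall a, L a -> g j a < M ->
      exists2 b, b \in B & all (fun k => g k b <= g k a) (j :: s).
  elim: M {ltM} => [|m [B LB domB]]; first by exists [::].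
  have [C LC domC] := IH (fun a => L a /\ g j a = m).
  exists (B ++ C) => [a|a La]; first by rewrite mem_cat => /orP[/LB|/LC[]].
  rewrite ltnS leq_eqVlt => /orP[/eqP gm|/(domB _ La)[b bB ba]].
    have [b bC ba] := domC a (conj La gm).
    exists b; first by rewrite mem_cat bC orbT.
    by have [_ e] := LC _ bC; rewrite /= ba andbT e gm.
  by exists b => //; rewrite mem_cat bB.
exists (B0 ++ B1) => [a|a La]; first by rewrite mem_cat => /orP[/LB0|/LB1].
have [ltaM|leMa] := ltnP (g j a) M.
  by have [b bB ba] := domB1 a La ltaM; exists b; rewrite // mem_cat bB orbT.
have [b bB ba] := domB0 a La; exists b; first by rewrite mem_cat bB.
by rewrite /= ba andbT (leq_trans (ltM _ bB)).
Qed.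

Lemma dickson (A : eqType) (J : finType) (g : J -> A -> nat) (L : A -> Prop) :
  exists2 B : seq A, forall a, a \in B -> L a &
    forall a, L a -> exists2 b, b \in B & forall j, g j b <= g j a.
Proof.
have [B LB domB] := dickson_seq g (enum J) L; exists B => // a /domB[b bB ba].
by exists b => // j; have /allP/(_ j) := ba; apply; rewrite mem_enum.
Qed.

End Dickson.

Section Lexicographic.
Variables (R : realType) (A : eqType) (J : Type) (f : J -> A -> R).

Fixpoint lexlt (s : seq J) (a b : A) : bool :=
  if s is j :: s' then (f j a < f j b) || (f j a == f j b) && lexlt s' a b
  else false.

Lemma lexlt_irr s a : lexlt s a a = false.
Proof. by elim: s => //= j s ->; rewrite ltxx andbF. Qed.

Lemma lexlt_trans s : transitive (lexlt s).
Proof.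
elim: s => //= j s IH b a c /orP[ab|/andP[/eqP-> ab]] /orP[bc|/andP[/eqP<- bc]].
- by rewrite (lt_trans ab bc).
- by rewrite ab.
- by rewrite bc.
- by rewrite eqxx (IH _ _ _ ab bc) orbT.
Qed.

Lemma lexlt_total s a b :
  [|| lexlt s a b, lexlt s b a | all (fun j => f j a == f j b) s].
Proof. by elim: s => //= j s IH; case: ltgtP. Qed.

Lemma lexlt_shift s (h : A -> A) :
  (forall j a b, f j (h a) - f j (h b) = f j a - f j b) ->
  forall a b, lexlt s (h a) (h b) = lexlt s a b.
Proof.
move=> sh a b; elim: s => //= j s ->.
by rewrite -subr_lt0 sh subr_lt0 -(subr_eq0 (f j (h a))) sh subr_eq0.
Qed.

End Lexicographic.

Lemma seq_max (A : eqType) (lt : rel A) : transitive lt ->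
  (forall a b, [|| lt a b, lt b a | a == b]) -> forall s : seq A, s != [::] ->
  exists2 x, x \in s & forall y, y \in s -> (y == x) || lt y x.
Proof.
move=> tr tot; elim=> // a [|b s] IH _.
  by exists a => [|y]; rewrite ?inE // => ->.
have [//|x xs xmax] := IH; have /or3P[ax|xa|/eqP ax] := tot a x.
- exists x => [|y]; rewrite in_cons ?xs ?orbT // => /orP[/eqP->|/xmax//].
  by rewrite ax orbT.
- exists a => [|y]; rewrite in_cons ?eqxx // => /orP[->//|/xmax/orP[/eqP->|yx]].
    by rewrite xa orbT.
  by rewrite (tr _ _ _ yx xa) orbT.
- exists a => [|y]; rewrite in_cons ?eqxx // => /orP[->//|/xmax].
  by rewrite ax.
Qed.

Lemma bounded_expo n (T : nat) :
  exists s : seq (expo n), forall a : expo n, (forall i, (a i <= T)%N) -> a \in s.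
Proof.
exists [seq [ffun i => nat_of_ord (f i)] | f : {ffun 'I_n -> 'I_T.+1}] => a aT.
apply/mapP; exists [ffun i => inord (a i)]; first by rewrite mem_enum.
by apply/ffunP => i; rewrite !ffunE inordK // ltnS.
Qed.

(** * Standard bases of submodules *)

(** The cancellation of a leading term: [P] and [G] have the leading terms [c x] and
    [c' y], and [x] is the leading term of [v y].  On the right every summand
    is a remainder after removal of a leading term. *)
Lemma reductionE (K : fieldType) (D : algType K) (V : lmodType D) (c c' : K)
    (v : D) (P G x y : V) : c' != 0 ->
  P - ((c / c') *: v) *: G = (P - c%:A *: x)
    - (c / c')%:A *: (v *: (G - c'%:A *: y)) - c%:A *: (v *: y - x).
Proof.
move=> c'0.
have e : c%:A * v = (c / c')%:A * (v * c'%:A).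
  by rewrite -!scalerAl !mul1r -scalerAr mulr1 scalerA divfK.
rewrite !scalerBr !scalerA -mulrA -e -scalerAl mul1r !opprB.
by rewrite -[RHS]addrA [X in _ = _ + X]addrC !subrKA.
Qed.

Section StandardBasis.
Variables (R : realType) (n : nat) (w : 'I_n -> R) (K : fieldType).
Variables (q : nat) (t : 'I_q -> R).
Local Notation D := (weyl n K).
Local Notation mon := (expo n * expo n)%type.
Local Notation wt := (wt w).
Local Notation pos := (mon * 'I_q)%type.
Implicit Types (P : 'rV[D]_q) (x y : pos) (v : mon).

Definition ordkey (k : option (option ('I_n + 'I_n + unit))) x : R :=
  match k with
  | None => wt x.1 + t x.2
  | Some None => (tdg x.1)%:R
  | Some (Some (inl (inl i))) => (x.1.1 i)%:R
  | Some (Some (inl (inr i))) => (x.1.2 i)%:R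
  | Some (Some (inr _)) => (x.2 : nat)%:R
  end.

(** Monomials are compared by weight, then by total degree, then
    lexicographically.  The total degree in second position makes the leading
    monomial multiplicative, since by [wmon_mulE] commutators keep the weight. *)
Definition plt : rel pos :=
  lexlt ordkey [:: None, Some None & [seq Some (Some i) | i <- enum {: 'I_n + 'I_n + unit}]].

Lemma plt_trans : transitive plt.
Proof. exact: lexlt_trans. Qed.

Lemma plt_total x y : [|| plt x y, plt y x | x == y].
Proof.
rewrite /plt; have /or3P[->|->|/= /and3P[_ _ /allP h]] := lexlt_total ordkey
  [:: None, Some None & [seq Some (Some i) | i <- enum {: 'I_n + 'I_n + unit}]] x y;
  rewrite ?orbT //.
apply/or3P/Or33/eqP.
have eqk i : ordkey (Some (Some i)) x = ordkey (Some (Some i)) y.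
  by apply/eqP/h/map_f; rewrite mem_enum.
rewrite [x]surjective_pairing [x.1]surjective_pairing.
rewrite [y]surjective_pairing [y.1]surjective_pairing; congr (_, _, _).
- apply/ffunP => i; apply/eqP; rewrite -(eqr_nat R); apply/eqP.
  exact: (eqk (inl (inl i))).
- apply/ffunP => i; apply/eqP; rewrite -(eqr_nat R); apply/eqP.
  exact: (eqk (inl (inr i))).
- apply/val_inj/eqP; rewrite -(eqr_nat R); apply/eqP.
  exact: (eqk (inr tt)).
Qed.

Definition pshift v x : pos := (v + x.1, x.2).

Lemma plt_shift v x y : plt (pshift v x) (pshift v y) = plt x y.
Proof.
apply: lexlt_shift => j {x y} x y.
have sh (a b c : nat) : (a + b)%:R - (a + c)%:R = b%:R - c%:R :> R.
  by rewrite !natrD opprD addrACA subrr add0r.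
case: j => [[[[i|i]|[]]|]|] //=; rewrite ?expoDE ?tdgD ?sh //.
by rewrite !wtD; ring.
Qed.

Lemma plt_tdg u v (j : 'I_q) : wt u = wt v -> (tdg u < tdg v)%N ->
  plt (u, j) (v, j).
Proof. by move=> uv lt; rewrite /plt /= uv eqxx ltr_nat lt orbT. Qed.

Definition below x P := forall j, supp_in (fun u => plt (u, j) x) (P 0 j).

Definition mono x : 'rV[D]_q := \row_j (if j == x.2 then wmon x.1 else 0).

Lemma belowB x P Q : below x P -> below x Q -> below x (P - Q).
Proof. by move=> bP bQ j; rewrite !mxE; exact: suppB. Qed.

Lemma belowZ (c : K) x P : below x P -> below x (c%:A *: P).
Proof. by move=> bP j; rewrite mxE -scalerAl mul1r; apply: suppZ. Qed.

Lemma below_wmon v x P : below x P -> below (pshift v x) (wmon v *: P).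
Proof.
move=> bP j; rewrite mxE.
apply: (supp_lin (f := @wmul n K (wmon v))) (bP j) => u ux /=.
rewrite -[wmul _ _]/(wmon v * wmon u) -(subrK (wmon (v + u)) (wmon v * wmon u)).
have ltux : plt (v + u, j) (pshift v x) by rewrite (plt_shift v (u, j)).
apply: suppD; last exact: supp_wmon.
apply: supp_sub (@wmon_mulE R n w K v u) => y [wy ty].
by apply: plt_trans ltux; apply: plt_tdg; rewrite ?wtD ?tdgD.
Qed.

Lemma mono_wmon v x : below (pshift v x) (wmon v *: mono x - mono (pshift v x)).
Proof.
move=> j; rewrite !mxE; case: eqP => [->|_]; last by rewrite mulr0 subrr; exact: supp0.
apply: supp_sub (@wmon_mulE R n w K v x.1) => y [wy ty].
by apply: plt_tdg; rewrite ?wtD ?tdgD.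
Qed.

Definition lead P x c := c != 0 /\ below x (P - c%:A *: mono x).

Lemma lead_exists P : P != 0 -> exists x, lead P x (P 0 x.2)@_x.1.
Proof.
move=> P0; pose s := flatten [seq [seq (u, j) | u <- msupp (P 0 j)] | j <- enum 'I_q].
have sP x : (x \in s) = ((P 0 x.2)@_x.1 != 0).
  rewrite mcoeff_neq0; apply/flattenP/idP => [[_ /mapP[j _ ->]] /mapP[u uP ->] //|xP].
  exists [seq (u, x.2) | u <- msupp (P 0 x.2)]; first by apply/map_f; rewrite mem_enum.
  by apply/mapP; exists x.1; rewrite // -surjective_pairing.
have [|x xs xmax] := seq_max plt_trans plt_total (s := s).
  apply: contra_neq P0 => s0; apply/rowP => j; rewrite mxE; apply: weylP => u.
  by apply/eqP/negPn; rewrite wcoeff0 -(sP (u, j)) s0.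
exists x; split; first by rewrite -sP.
move=> j u; rewrite !mxE -scalerAl mul1r wcoeffB wcoeffZ.
have [->|jx] := eqVneq j x.2.
  rewrite mcoeff_wmon; have [<-|ux] := eqVneq x.1 u; first by rewrite mulr1 subrr eqxx.
  rewrite mulr0 subr0 -(sP (u, x.2)) => /xmax /orP[/eqP e|//].
  by rewrite -e eqxx in ux.
rewrite wcoeff0 mulr0 subr0 -(sP (u, j)) => /xmax /orP[/eqP e|//].
by rewrite -e eqxx in jx.
Qed.

Definition bnd T P := forall j, supp_in (fun u => (tdg u <= T)%N) (P 0 j).

Lemma bnd_exists P : exists T, bnd T P.
Proof.
exists (\max_(j < q) \max_(u <- msupp (P 0%R j)) tdg u)%N => j u; rewrite mcoeff_neq0 => uP.
by apply: leq_trans (leq_bigmax j); apply: leq_bigmax_seq.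
Qed.

Lemma bnd_mul T T' v c P : bnd T' P -> (tdg v + T' <= T)%N ->
  bnd T ((c *: wmon v) *: P).
Proof.
move=> bP le j; rewrite mxE -scalerAl; apply: suppZ.
apply: (supp_lin (f := @wmul n K (wmon v))) (bP j) => u ux /=.
rewrite -[wmul _ _]/(wmon v * wmon u) -(subrK (wmon (v + u)) (wmon v * wmon u)).
apply: suppD; last first.
  by apply: supp_wmon; rewrite tdgD (leq_trans _ le) // leq_add2l.
apply: supp_sub (@wmon_mulE R n w K v u) => y [_ ty].
by apply: leq_trans le; apply: ltnW (leq_trans ty _); rewrite leq_add2l.
Qed.

Lemma bndB T P Q : bnd T P -> bnd T Q -> bnd T (P - Q).
Proof. by move=> bP bQ j; rewrite !mxE; exact: suppB. Qed.

Lemma bounded_pos T : exists s : seq pos, forall x, (tdg x.1 <= T)%N -> x \in s.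
Proof.
have [s sT] := bounded_expo n T.
exists [seq (u, j) | u <- [seq (a, b) | a <- s, b <- s], j <- enum 'I_q] => x xT.
rewrite [x]surjective_pairing allpairs_f ?mem_enum // [x.1]surjective_pairing.
by apply: allpairs_f; apply: sT => i; apply: leq_trans xT; rewrite /tdg;
  [apply: leq_trans (leq_addr _ _)|apply: leq_trans (leq_addl _ _)];
  rewrite (bigD1 i) //= leq_addr.
Qed.

Lemma mono_coef (c : K) x P j u : ((P - c%:A *: mono x) 0 j)@_u =
  (P 0 j)@_u - c * ((u, j) == x)%:R.
Proof.
rewrite !mxE -scalerAl mul1r wcoeffB wcoeffZ; congr (_ - _ * _).
case: x => u' j' /=; rewrite xpair_eqE andbC.
by have [_|] := eqVneq j j'; rewrite ?wcoeff0 // mcoeff_wmon eq_sym.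
Qed.

Lemma lead_coefE P x c : lead P x c -> (P 0 x.2)@_x.1 = c.
Proof.
case=> _ /(_ x.2 x.1); rewrite mono_coef -surjective_pairing eqxx mulr1.
have [/eqP|_ /(_ isT)] := eqVneq ((P 0 x.2)@_x.1 - c) 0.
  by rewrite subr_eq0 => /eqP.
by rewrite /plt lexlt_irr.
Qed.

Lemma lead_supp P x c j u : lead P x c -> (P 0 j)@_u != 0 ->
  ((u, j) == x) || plt (u, j) x.
Proof.
case=> _ /(_ j u); rewrite mono_coef; have [//|_] := eqVneq (u, j) x.
by rewrite mulr0 subr0 => h /h.
Qed.

Lemma lead_fil P x c : lead P x c -> mfil w true (fun _ => wt x.1 + t x.2) t P.
Proof.
move=> lP i j u; rewrite ord1 => /(lead_supp lP) /orP[/eqP<-|] /=.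
  by rewrite lexx.
by rewrite /plt /=; case: ltgtP.
Qed.

Variable N : 'rV[D]_q -> Prop.
Hypothesis subN : is_submod N.

(** The leading exponents of an element, recorded with the slack that the bound
    [T] leaves above the total degree (the exponent of the homogenizing variable).
    A position [j] is encoded by both [j] and [q - j], so that domination forces
    equality of positions. *)
Definition domkey (k : 'I_n + 'I_n + 'I_3) (a : 'rV[D]_q * pos * nat) : nat :=
  match k with
  | inl (inl i) => a.1.2.1.1 i
  | inl (inr i) => a.1.2.1.2 i
  | inr i => nth 0%N [:: (a.2 - tdg a.1.2.1)%N; (a.1.2.2 : nat);
                         (q - a.1.2.2)%N] i
  end.

Lemma domkey_le (a a' : 'rV[D]_q * pos * nat) :
  (tdg a.1.2.1 <= a.2)%N -> (tdg a'.1.2.1 <= a'.2)%N ->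
  (forall k, (domkey k a' <= domkey k a)%N) ->
  exists2 v, a.1.2 = pshift v a'.1.2 & (tdg v + a'.2 <= a.2)%N.
Proof.
case: a a' => [[P [u j]] T] [[P' [u' j']] T'] /= uT u'T' le.
have ej : j = j'.
  apply/val_inj; have /= := le (inr (inord 1)); have /= := le (inr (inord 2)).
  by rewrite !inordK //=; case: j j' {le} => j /= + [j' /=]; lia.
pose v : mon := ([ffun i => (u.1 i - u'.1 i)%N], [ffun i => (u.2 i - u'.2 i)%N]).
have eu : u = v + u'.
  rewrite [u in LHS]surjective_pairing; congr (_, _); apply/ffunP => i.
    by rewrite expoDE ffunE subnK //; exact: (le (inl (inl i))).
  by rewrite expoDE ffunE subnK //; exact: (le (inl (inr i))).
exists v; first by rewrite /pshift /= -eu ej.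
have /= := le (inr (inord 0)); rewrite inordK //=; move: uT u'T'.
by rewrite eu tdgD; lia.
Qed.

(** Dividing [P] by the basis terminates although the weights of the remainders
    need not be bounded below, because all remainders stay within a bound [T] of
    the total degree of [P].  To preserve the bound, the leading monomials are
    recorded together with the slack between [T] and their total degree, and
    Dickson's lemma is applied to these data; this is what homogenizing the Weyl
    algebra would achieve. *)
Theorem standard_basis : exists g (G : 'M[D]_(g, q)) (e : 'I_g -> R),
  [/\ forall k, N (row k G), mfil w true e t G &
   forall P d, N P -> mfil w true (fun _ => d) t P ->
   exists2 Q : 'rV_g, P = Q *m G & mfil w true (fun _ => d) e Q].
Proof.
have [N0 ND NZ] := subN.
pose L (a : 'rV[D]_q * pos * nat) := [/\ N a.1.1,
  exists c, lead a.1.1 a.1.2 c, bnd a.2 a.1.1 & (tdg a.1.2.1 <= a.2)%N].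
have [B LB domB] := dickson domkey L.
pose b (k : 'I_(size B)) := tnth (in_tuple B) k.
have Lb k : L (b k) by apply: LB; exact: mem_tnth.
pose e k := wt (b k).1.2.1 + t (b k).1.2.2.
have leadT P x c T : lead P x c -> bnd T P -> (tdg x.1 <= T)%N.
  by move=> lP PT; apply: (PT x.2); rewrite (lead_coefE lP); case: lP.
exists (size B), (\matrix_k (b k).1.1), e; split.
- by move=> k; rewrite rowK; have [] := Lb k.
- by apply/mfil_row => k; rewrite rowK; have [_ [c /lead_fil]] := Lb k.
move=> P d NP Pd; have [T PT] := bnd_exists P; have [s sT] := bounded_pos T.
have [m] : exists m, forall x, (P 0 x.2)@_x.1 != 0 -> (count (plt^~ x) s < m)%N.
  by exists (size s).+1 => x _; rewrite ltnS count_size.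
elim: m P NP Pd PT => [|m IH] P NP Pd PT ltm.
  exists 0; last exact: mfil0.
  rewrite mul0mx; apply/eqP; apply: contraT => /lead_exists[x [xP _]].
  by have := ltm x xP.
have [->|/lead_exists[x leadP]] := eqVneq P 0.
  by exists 0; rewrite ?mul0mx //; exact: mfil0.
set c := _@__ in leadP; have xT := leadT _ _ _ _ leadP PT.
have [a' aB le] := domB (P, x, T)
  (And4 NP (ex_intro _ c leadP) PT xT).
have /tnthP[k ak] : a' \in in_tuple B by [].
move: le; rewrite ak -/(b k) => le {a' aB ak}.
have [NG [c' leadG] GT uT] := Lb k.
have [//|//|//|v /= xE vT] := domkey_le (a := (P, x, T)) (a' := b k).
set G := (b k).1.1 in NG leadG GT.
pose cv : D := (c / c') *: wmon v.
have bP' : below x (P - cv *: G).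
  have [c'0 bG] := leadG; have [_ bP] := leadP; rewrite xE in bP *.
  set y := (b k).1.2 in bG bP *.
  have redE := @reductionE _ (weyl n K) _ c c' (wmon v) P G (mono (pshift v y))
    (mono y) c'0.
  have b1 := belowZ (c := c / c') (below_wmon (v := v) bG).
  have b2 := belowZ (c := c) (@mono_wmon v y).
  by rewrite /cv redE; exact: (belowB (belowB bP b1) b2).
have wtv : wt v + e k <= d.
  have [c0 _] := leadP; have := Pd 0 x.2 x.1; rewrite (lead_coefE leadP).
  by move=> /(_ c0) /=; rewrite xE /= wtD addrA.
have cvd : mfil w true (fun _ => d) e (cv *: delta_mx 0 k : 'rV_(size B)).
  move=> i j; rewrite !mxE ord1 eqxx /=.
  have [->|_] := eqVneq j k; last by rewrite mulr0; exact: supp0.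
  by rewrite mulr1; apply: suppZ; apply: supp_wmon.
have cvG : (cv *: delta_mx 0 k) *m (\matrix_k0 (b k0).1.1) = cv *: G :> 'rV_q.
  by rewrite -scalemxAl -rowE rowK.
have NP' : N (P - cv *: G).
  by apply: ND => //; rewrite -scaleN1r; do 2 apply: (NZ).
have bT : bnd T (P - cv *: G) by apply: bndB => //; apply: bnd_mul GT _.
have [|//||Q QE Qd] := IH (P - cv *: G) NP'.
- apply: mfilB => //; rewrite -cvG; apply: (mfilM cvd).
  by apply/mfil_row => l; rewrite rowK; have [_ [? /lead_fil]] := Lb l.
- move=> y yP; have yx : plt y x.
    by rewrite [y]surjective_pairing; apply: bP' yP.
  have ys : y \in s by apply: sT; apply: bT yP.
  have := ltm x; rewrite (lead_coefE leadP) => /(_ (proj1 leadP)).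
  rewrite ltnS; apply: leq_trans.
  have sub : subpred (predU (pred1 y) (plt^~ y)) (plt^~ x).
    by move=> z /= /orP[/eqP->//|zy]; exact: plt_trans yx.
  apply: leq_trans (sub_count sub s).
  have := count_predUI (pred1 y) (plt^~ y) s.
  rewrite [count (predI _ _) s](@eq_count _ _ pred0) ?count_pred0 ?addn0.
    by move=> ->; rewrite -add1n leq_add2r -has_count has_pred1.
  by move=> z /=; case: eqP => //= ->; exact: lexlt_irr.
exists (Q + cv *: delta_mx 0 k); last exact: mfilD.
by rewrite mulmxDl -QE cvG subrK.
Qed.

End StandardBasis.

(** * Strictness of the order filtration *)

Section Strictness.
Variables (R : realType) (n : nat) (w : 'I_n -> R) (K : fieldType).
Local Notation D := (weyl n K).
Local Notation mon := (expo n * expo n)%type.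
Local Notation wt := (wt w).

Lemma pos_gap (r : seq R) : (forall x, x \in r -> 0 < x) ->
  exists2 eps, 0 < eps & forall x, x \in r -> eps <= x.
Proof.
elim: r => [_|x r IH rpos]; first by exists 1.
have [|eps e0 ler] := IH; first by move=> y yr; apply: rpos; rewrite inE yr orbT.
exists (Num.min x eps); first by rewrite lt_min e0 rpos // mem_head.
move=> y; rewrite inE ge_min => /orP[/eqP->|/ler->]; rewrite ?lexx ?orbT //.
Qed.

Lemma mfil_gap p q s t (A : 'M[D]_(p, q)) : mfil w false s t A ->
  exists2 eps, 0 < eps & mfil w true (fun i => s i - eps) t A.
Proof.
move=> FA; pose r := [seq s ij.1 - (wt u + t ij.2) | ij <- enum {: 'I_p * 'I_q},
  u <- msupp (A ij.1 ij.2)].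
have [|eps e0 ler] := @pos_gap r.
  move=> x /allpairsPdep[[i j] [u [_ uA ->]]]; rewrite subr_gt0.
  by apply: (FA i j); rewrite mcoeff_neq0.
exists eps => // i j u; rewrite mcoeff_neq0 => uA.
rewrite /= lerBrDr -lerBrDl; apply: ler; apply/allpairsPdep.
by exists (i, j), u; rewrite mem_enum.
Qed.

Lemma mfil_bound p q s t (A : 'M[D]_(p, q)) :
  exists k, mfil w true (fun i => s i + k) t A.
Proof.
pose r := [seq Num.max 1 (wt u + t ij.2 - s ij.1) | ij <- enum {: 'I_p * 'I_q},
  u <- msupp (A ij.1 ij.2)].
have [|eps e0 ler] := @pos_gap [seq x^-1 | x <- r].
  move=> _ /mapP[x /allpairsPdep[ij [u [_ _ ->]] ->]].
  by rewrite invr_gt0 lt_max ltr01.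
exists (eps^-1) => i j u; rewrite mcoeff_neq0 => uA.
rewrite /= -lerBlDl; apply: (@le_trans _ _ (Num.max 1 (wt u + t j - s i))).
  by rewrite le_max lexx orbT.
rewrite -[X in X <= _]invrK lef_pV2 ?posrE ?invr_gt0 ?lt_max ?ltr01 //.
apply: ler; apply: map_f; apply/allpairsPdep.
by exists (i, j), u; rewrite mem_enum.
Qed.

Lemma mfil1 p (s : 'I_p -> R) : mfil w true s s (1%:M : 'M[D]_p).
Proof.
move=> i j; rewrite mxE; have [->|_] := eqVneq i j; last exact: supp0.
apply: supp_wmon => /=; rewrite /wt big1 ?add0r // => k _.
by rewrite !ffunE subrr mulr0.
Qed.

Lemma row_choice (g q : nat) (X : 'I_g -> 'rV[D]_q -> Prop) :
  (forall k, exists Q, X k Q) -> exists M : 'M_(g, q), forall k, X k (row k M).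
Proof.
by move=> /choice[f fX]; exists (\matrix_k f k) => k; rewrite rowK.
Qed.

Variables (p q : nat) (s : 'I_p -> R) (t : 'I_q -> R) (psi : 'M[D]_(p, q)).
Variable N : 'rV[D]_q -> Prop.
Hypotheses (subN : is_submod N) (Npsi : forall P, N P <-> exists Q, P = Q *m psi).
Hypothesis approx : forall P d, N P -> mfil w true (fun _ => d) t P ->
  exists2 Q : 'rV_p, mfil w true (fun _ => d) s Q &
    mfil w false (fun _ => d) t (P - Q *m psi).

Lemma strict_le P d : N P -> mfil w true (fun _ => d) t P ->
  exists2 Q, P = Q *m psi & mfil w true (fun _ => d) s Q.
Proof.
have [g [G [e [NG Ge stdG]]]] := standard_basis w t subN.
suff [X GX Xe] : exists2 X, G = X *m psi & mfil w true e s X.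
  move=> NP /(stdG _ _ NP)[Q -> Qd]; exists (Q *m X); first by rewrite GX mulmxA.
  exact: mfilM Qd Xe.
have [C GC] : exists C, forall k, row k G = row k C *m psi.
  by apply: (row_choice (X := fun k Q => row k G = Q *m psi)) => k; apply/Npsi.
have {}GC : G = C *m psi by apply/row_matrixP => k; rewrite GC row_mul.
have [kappa Ck] := mfil_bound e s C.
have [A /all_and2[As Alow]] : exists A, forall k,
    mfil w true (fun _ => e k) s (row k A) /\
    mfil w false (fun _ => e k) t (row k G - row k A *m psi).
  apply: (row_choice (X := fun k Q => mfil w true (fun _ => e k) s Q /\
    mfil w false (fun _ => e k) t (row k G - Q *m psi))) => k.
  have [|Q Q1 Q2] := approx (NG k) (d := e k).
    by move/mfil_row: Ge; apply.
  by exists Q.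
have {}As : mfil w true e s A by apply/mfil_row.
have [eps e0 GA] : exists2 eps, 0 < eps &
    mfil w true (fun k => e k - eps) t (G - A *m psi).
  apply: mfil_gap; apply/mfil_row => k.
  by rewrite linearB /= row_mul; apply: Alow.
have [S /all_and2[GS Se]] : exists S, forall k,
    row k (G - A *m psi) = row k S *m G /\
    mfil w true (fun _ => e k - eps) e (row k S).
  apply: (row_choice (X := fun k Q => row k (G - A *m psi) = Q *m G /\
    mfil w true (fun _ => e k - eps) e Q)) => k.
  have [||Q Q1 Q2] := stdG (row k (G - A *m psi)) (e k - eps).
  - have [_ ND NZ] := subN.
    have NA : N (row k (A *m psi)) by apply/Npsi; exists (row k A); rewrite row_mul.
    by have := ND _ _ (NG k) (NZ (-1) _ NA); rewrite scaleN1r -linearB.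
  - by move/mfil_row: GA; apply.
  by exists Q.
have {}Se : mfil w true (fun k => e k - eps) e S by apply/mfil_row.
have {}GS : G = A *m psi + S *m G.
  by apply/row_matrixP => k; rewrite linearD /= [row k (S *m G)]row_mul -GS
    linearB /= addrC subrK.
have iter m : exists Q Z, [/\ G = Q *m psi + Z *m G, mfil w true e s Q &
    mfil w true (fun k => e k - m%:R * eps) e Z].
  elim: m => [|m [Q [Z [GQZ Qs Ze]]]].
    exists 0, 1%:M; split; [by rewrite mul0mx mul1mx add0r|exact: mfil0|].
    by apply: mfil_le (mfil1 e) => i; rewrite mul0r subr0.
  exists (Q + Z *m A), (Z *m S); split.
  - rewrite mulmxDl -(mulmxA Z A) -(mulmxA Z S).
    rewrite -addrA -mulmxDr; apply: etrans GQZ _.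
    exact: (congr1 (fun X => Q *m psi + Z *m X) GS).
  - apply: mfilD => //; apply: mfil_le (mfilM Ze As) => i.
    by rewrite gerBl mulr_ge0 ?ler0n // ltW.
  - have := mfilM (mfil_shift (- eps) Ze) Se.
    by apply: mfil_le => i; rewrite -addn1 natrD mulrDl mul1r opprD addrA.
(* Enough steps to make up for the order [kappa] of [C]. *)
have [m lem] : exists m : nat, kappa <= m%:R * eps.
  exists (Num.bound (`|kappa| / eps)); rewrite -ler_pdivrMr //.
  apply: le_trans (ltW (archi_boundP _)); last by rewrite divr_ge0 // ltW.
  by rewrite ler_pM2r ?invr_gt0 // ler_norm.
have [Q [Z [GQZ Qs Ze]]] := iter m; exists (Q + Z *m C).
  by rewrite mulmxDl -mulmxA -GC.
apply: mfilD => //; apply: mfil_le (mfilM (mfil_shift kappa Ze) Ck) => i.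
by rewrite -addrA gerDl addrC subr_le0.
Qed.

(** The submodule [N] meets each step of the filtration in the image of the
    corresponding step, although cancelling leading terms with [approx] may never
    terminate.  In terms of a finite standard basis [G] and the generators [psi],
    cancelling reads [G = A psi + S G] with [S] lowering the order by some positive
    [eps]; iterating pushes the error term down to [S^m G], and there the crude
    expression [G = C psi], of some order [kappa], does no harm. *)
Theorem strictness C P d : N P -> mfil w C (fun _ => d) t P ->
  exists2 Q, P = Q *m psi & mfil w C (fun _ => d) s Q.
Proof.
case: C => NP Pd; first exact: strict_le.
have [eps e0 Pe] := mfil_gap Pd.
have [Q PQ Qe] := strict_le NP Pe; exists Q => // i j.
apply: supp_sub (Qe i j) => u /= le; apply: le_lt_trans le _.
by rewrite gtrBl.
Qed.

End Strictness.

(** * Homogeneous parts and initial forms *)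

Section Homogeneous.
Variables (R : realType) (n : nat) (w : 'I_n -> R) (K : fieldType).
Local Notation D := (weyl n K).
Local Notation mon := (expo n * expo n)%type.
Local Notation wt := (wt w).

Definition hpart (a : R) (P : D) : D :=
  locked (\sum_(u <- msupp P | wt u == a) P@_u *: wmon u).

Lemma hpartE a P : hpart a P = \sum_(u <- msupp P | wt u == a) P@_u *: wmon u.
Proof. by rewrite /hpart -lock. Qed.

Lemma hpart_supp a P : supp_in (fun u => wt u = a) (hpart a P).
Proof.
by rewrite hpartE; apply: supp_sum => u _ /eqP ua; apply: suppZ; apply: supp_wmon.
Qed.

Lemma supp_coef0 (S : mon -> Prop) (P : D) u : supp_in S P -> ~ S u -> P@_u = 0.
Proof. by move=> SP nS; apply/eqP; apply: contraT => /SP. Qed.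

Lemma hpart_rest a (P : D) : supp_in (fun u => wt u <> a) (P - hpart a P).
Proof.
rewrite {1}(weylE P) (bigID (fun u => wt u == a)) /= -hpartE.
rewrite addrAC subrr add0r.
by apply: supp_sum => u _ /eqP ua; apply: suppZ; apply: supp_wmon.
Qed.

Lemma hpart_coef a (P : D) u : (hpart a P)@_u = if wt u == a then P@_u else 0.
Proof.
have [ua|ua] := eqVneq (wt u) a; last first.
  by apply: supp_coef0 (@hpart_supp a P) _; apply/eqP.
have := supp_coef0 (@hpart_rest a P) (u := u); rewrite wcoeffB => /(_ (fun h => h ua)).
by move/eqP; rewrite subr_eq0 => /eqP.
Qed.

Lemma hpartD a (P Q : D) : hpart a (P + Q) = hpart a P + hpart a Q.
Proof.
apply: weylP => u; apply: etrans (hpart_coef _ _ _) _.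
apply/esym/(etrans (wcoeffD _ _ _)).
have := congr2 +%R (hpart_coef a P u) (hpart_coef a Q u).
have := wcoeffD P Q u; case: (wt u == a) => e e'.
  exact: etrans e' (esym e).
exact: etrans e' (addr0 0).
Qed.

Lemma hpart0 a : hpart a (0 : D) = 0.
Proof. by apply: weylP => u; rewrite hpart_coef wcoeff0 if_same. Qed.

(** Weights are additive, so multiplying by a homogeneous element shifts the
    grading. *)
Lemma hpartM a b (Q H : D) : supp_in (fun u => wt u = b) H ->
  hpart (a + b) (Q * H) = hpart a Q * H.
Proof.
move=> hH; apply: weylP => v; rewrite [LHS]hpart_coef.
have mulwt (S : mon -> Prop) (A : D) : supp_in S A ->
    supp_in (fun y => exists u x, [/\ S u, wt x = b & wt y = wt (u + x)]) (A * H).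
  move=> SA; apply: supp_mul SA hH => u x Su xb.
  by apply: supp_sub (@wmon_mul_wt R n w K u x) => y ->; exists u, x; rewrite wtD.
have e : Q * H = hpart a Q * H + (Q - hpart a Q) * H by rewrite -mulrDl addrC subrK.
have [va|va] := eqVneq (wt v) (a + b).
  rewrite e wcoeffD [X in _ + X](@supp_coef0 _ _ v (mulwt _ _ (@hpart_rest a Q))).
    by rewrite addr0.
  by case=> u [x [ua xb]]; rewrite va wtD xb => /addIr/esym.
rewrite (@supp_coef0 _ _ v (mulwt _ _ (@hpart_supp a Q))) //.
by case=> u [x [ua xb]] e'; case/eqP: va; rewrite e' wtD ua xb.
Qed.

End Homogeneous.

Lemma submod_gen_rows (D : nzRingType) p q (M : 'M[D]_(p, q)) (P : 'rV[D]_q) :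
  submod_gen (fun S => exists j, S = row j M) P <-> exists Q, P = Q *m M.
Proof.
split=> [|[Q ->] N [N0 ND NZ] sN].
  move=> /(_ (fun P => exists Q, P = Q *m M)); apply=> [|_ [j ->]]; last first.
    by exists (delta_mx 0 j); rewrite -rowE.
  split=> [|u v [Q ->] [Q' ->]|a u [Q ->]]; first by exists 0; rewrite mul0mx.
    by exists (Q + Q'); rewrite mulmxDl.
  by exists (a *: Q); rewrite -scalemxAl.
rewrite mulmx_sum_row; apply: (big_ind N) => // j _.
by apply: NZ; apply: sN; exists j.
Qed.

Lemma submod_gen_sub (D : nzRingType) (V : lmodType D) (S : V -> Prop) :
  is_submod (submod_gen S).
Proof.
split=> [N [N0]|u v Su Sv N subN SN|a u Su N subN SN] //; case: (subN) => _ ND NZ.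
  by apply: ND; [apply: Su|apply: Sv].
by apply: NZ; apply: Su.
Qed.

Section InitialForms.
Variables (R : realType) (n : nat) (w : 'I_n -> R).
Local Notation K := R[i].
Local Notation D := (weyl n K).
Local Notation mon := (expo n * expo n)%type.
Local Notation wt := (wt w).
Local Notation rsh t := (fun j => (t j)%:~R : R).

(** Once the order [e] is attained, the initial form consists of the monomials of
    exact order [e], whose weight in position [j] is [e] minus the shift there. *)
Lemma initE q (t : 'I_q -> int) (P : 'rV[D]_q) e j0 u0 :
  mfil w true (fun _ => e) (rsh t) P -> (P 0 j0)@_u0 != 0 ->
  wt u0 + (t j0)%:~R = e ->
  init w t P = \row_j hpart w (e - (t j)%:~R) (P 0 j).
Proof.
move=> Pe; rewrite mcoeff_neq0 => u0P u0e; apply/rowP => j; rewrite !mxE hpartE.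
rewrite big_seq_cond [RHS]big_seq_cond; apply: eq_bigl => u.
have [uP|//] := boolP (u \in msupp _).
have ule j' u' : u' \in msupp (P 0 j') -> tdeg w t u' j' <= e.
  by rewrite -mcoeff_neq0 => /(Pe 0 j').
rewrite /= -[X in _ = X](inj_eq (addIr (t j)%:~R)) subrK.
apply/forallP/eqP => [/(_ j0)/allP/(_ u0 u0P)|ue j'].
  by rewrite [X in X <= _]u0e => ele; apply/le_anti; rewrite ele ule.
by apply/allP => u' u'P; rewrite [X in _ <= X]ue; exact: ule.
Qed.

Lemma init0 q (t : 'I_q -> int) : init w t (0 : 'rV[D]_q) = 0.
Proof.
by apply/rowP => j; rewrite !mxE msupp0 big_seq_cond big1 // => u /andP[].
Qed.

Lemma mfil_hpart q (t : 'I_q -> int) (P : 'rV[D]_q) e :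
  mfil w true (fun _ => e) (rsh t) P ->
  mfil w false (fun _ => e) (rsh t) (P - \row_j hpart w (e - (t j)%:~R) (P 0 j)).
Proof.
move=> Pe i j u; rewrite !mxE ord1 wcoeffB hpart_coef.
have [_|ue] := eqVneq (wt u) (e - (t j)%:~R); first by rewrite subrr eqxx.
rewrite subr0 => /(Pe 0 j) /=; rewrite le_eqVlt => /orP[/eqP ue'|//].
by rewrite -ue' addrK eqxx in ue.
Qed.

Variables (p q : nat) (s : 'I_p -> int) (t : 'I_q -> int) (psi : 'M[D]_(p, q)).
Hypothesis psi_ord : forall j, row j psi != 0 ->
  is_ord w t (row j psi) (s j)%:~R.

Lemma psi_fil : mfil w true (rsh s) (rsh t) psi.
Proof.
apply/mfil_row => i i0 j u; rewrite {i0}ord1; have [->|/psi_ord[_ le]] := eqVneq (row i psi) 0.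
  by rewrite mxE wcoeff0 eqxx.
by rewrite mcoeff_neq0 => /le.
Qed.

Lemma init_rowE j : init w t (row j psi) =
  \row_l hpart w ((s j)%:~R - (t l)%:~R) (row j psi 0 l).
Proof.
have [r0|rn0] := eqVneq (row j psi) 0.
  rewrite r0 init0; apply/rowP => l; rewrite [RHS]mxE [in RHS]mxE [LHS]mxE.
  by rewrite hpart0.
have [[l [u [uP ue]]] _] := psi_ord rn0.
have F : mfil w true (fun _ => (s j)%:~R) (rsh t) (row j psi).
  by move/mfil_row: psi_fil; apply.
by rewrite -mcoeff_neq0 in uP; exact: initE F uP ue.
Qed.

(** A homogeneous combination of initial forms of rows may be taken with
    homogeneous coefficients; the same coefficients then combine the rows
    themselves to the given element up to terms of lower order. *)
Lemma init_lift (P : 'rV[D]_q) e :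
  (forall l, supp_in (fun u => wt u = e - (t l)%:~R) (P 0 l)) ->
  submod_gen (fun S => exists j, S = init w t (row j psi)) P ->
  exists2 Q : 'rV_p, mfil w true (fun _ => e) (rsh s) Q &
    mfil w false (fun _ => e) (rsh t) (P - Q *m psi).
Proof.
move=> hP; pose ipsi : 'M[D]_(p, q) := \matrix_j init w t (row j psi).
have -> : (fun S => exists j, S = init w t (row j psi)) =
    (fun S => exists j, S = row j ipsi).
  by apply/funext => S; apply/propext; split=> -[j ->]; exists j; rewrite rowK.
move/submod_gen_rows => [Q PQ].
pose Q' : 'rV[D]_p := \row_j hpart w (e - (s j)%:~R) (Q 0 j).
have Q'e : mfil w true (fun _ => e) (rsh s) Q'.
  move=> i j; rewrite mxE; apply: supp_sub (@hpart_supp _ _ w _ _ _) => u -> /=.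
  by rewrite subrK.
exists Q' => //.
have -> : P - Q' *m psi = - (Q' *m (psi - ipsi)).
  rewrite mulmxBr opprB; congr (_ - _).
  apply/rowP => l; rewrite [RHS]mxE.
  have -> : P 0 l = hpart w (e - (t l)%:~R) (P 0 l).
    apply: weylP => u; rewrite hpart_coef; case: eqP => // ue.
    exact: supp_coef0 (hP l) ue.
  rewrite PQ !mxE (big_morph _ (@hpartD _ _ w _ _) (@hpart0 _ _ w _ _)); apply: eq_bigr => j _.
  have -> : ipsi j l = hpart w ((s j)%:~R - (t l)%:~R) (psi j l).
    by rewrite mxE init_rowE mxE; congr (hpart _ _ _); rewrite mxE.
  rewrite [Q' 0 j]mxE -(@hpartM _ _ w _ _ _ _ _ (@hpart_supp _ _ w _ _ _)); congr (hpart _ _ _).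
  by rewrite addrA subrK.
apply: mfilN; rewrite -[false]/(true && false); apply: mfilM Q'e _.
apply/mfil_row => j; rewrite linearB /= [row j ipsi]rowK init_rowE.
have /(mfil_hpart) : mfil w true (fun _ => (s j)%:~R) (rsh t) (row j psi).
  by move/mfil_row: psi_fil; apply.
exact.
Qed.

(** If the initial module is generated by the initial forms of the rows, then the
    leading form of any element of [N] can be cancelled; this is the hypothesis of
    [strictness]. *)
Lemma approx_of_init (N : 'rV[D]_q -> Prop) :
  (forall Q, init_submod w t N Q ->
     submod_gen (fun S => exists j, S = init w t (row j psi)) Q) ->
  forall P e, N P -> mfil w true (fun _ => e) (rsh t) P ->
  exists2 Q : 'rV_p, mfil w true (fun _ => e) (rsh s) Q &
    mfil w false (fun _ => e) (rsh t) (P - Q *m psi).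
Proof.
move=> initN P e NP Pe.
have [[j0 [u0 [u0P u0e]]]|low] := pselect (exists j0 u0,
    (P 0 j0)@_u0 != 0 /\ wt u0 + (t j0)%:~R = e); last first.
  exists 0; [exact: mfil0|rewrite mul0mx subr0 => i j u uP].
  have := Pe i j u uP; rewrite /= le_eqVlt => /orP[/eqP ue|//].
  by case: low; exists j, u; split; rewrite // -(ord1 i).
have iP := initE Pe u0P u0e.
have [||Q Qe PQ] := @init_lift (init w t P) e.
- by move=> l; rewrite iP mxE; exact: hpart_supp.
- by apply: initN => M subM genM; apply: genM; exists P.
exists Q; first exact: Qe.
have -> : P - Q *m psi = (P - init w t P) + (init w t P - Q *m psi).
  by rewrite addrA subrK.
by apply: mfilD PQ; rewrite iP; exact: mfil_hpart.
Qed.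

End InitialForms.

(** * The Euler operator *)

Lemma comm_sum (K : comNzRingType) (D : algType K) (I : eqType) (r : seq I)
    (c : I -> K) (m : I -> D) (x y : D) :
  (forall i, i \in r -> x * m i = m i * y) ->
  x * (\sum_(i <- r) c i *: m i) = (\sum_(i <- r) c i *: m i) * y.
Proof.
move=> xy; rewrite mulr_sumr mulr_suml big_seq [RHS]big_seq.
by apply: eq_bigr => i /xy e; rewrite -scalerAr -scalerAl e.
Qed.

Lemma commA (K : comNzRingType) (D : algType K) (x y P : D) (c : K) :
  x * P = P * y -> (x + c%:A) * P = P * (y + c%:A).
Proof. by move=> e; rewrite mulrDl mulrDr e -scalerAl -scalerAr mul1r mulr1. Qed.

Lemma sum_commE (K : comNzRingType) (D : algType K) (I : finType) (c : I -> K)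
    (x : I -> D) (a b : I -> K) (m : D) (A : I -> D) :
  (forall i, x i * m = A i + a i *: m) -> (forall i, m * x i = A i + b i *: m) ->
  (\sum_i c i *: x i) * m =
  m * (\sum_i c i *: x i + (\sum_i c i * (a i - b i))%:A).
Proof.
move=> xm mx; rewrite mulrDr -scalerAr mulr1 mulr_suml mulr_sumr scaler_suml.
rewrite -big_split; apply: eq_bigr => i _ /=.
rewrite -scalerAl xm -scalerAr mx !scalerDr !scalerA -addrA -scalerDl -mulrDr.
by rewrite [b i + _]addrC subrK.
Qed.

Section Commutation.
Variables (n : nat) (K : comNzRingType).
Local Notation D := (weyl n K).
Local Notation mon := (expo n * expo n)%type.

Local Opaque wmon expo_pred expoU linext Xmul Dmul1 Dmul.

Lemma wxM i (P : D) : wx i * P = Xmul (expoU i) P.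
Proof. exact: etrans (wmul_mon (expoU i, 0) P) (congr1 _ (Dmul0 P)). Qed.

Lemma wdM i (P : D) : wd i * P = Dmul1 i P.
Proof.
apply: etrans (wmul_mon (0, expoU i) P) _; rewrite Xmul0 /=.
by rewrite -[expoU i]add0r DmulU Dmul0.
Qed.

Lemma wxwdE i : wx i * wd i = wmon (expoU i, expoU i) :> D.
Proof. by rewrite wmonM /= Dmul_mon0 Xmul_mon /= !addr0. Qed.

Lemma wxwd_wmon i (u : mon) : wx i * wd i * wmon u =
  wmon (u + (expoU i, expoU i)) + (u.1 i)%:R *: wmon u :> D.
Proof.
have L (c : K) (A B : D) :
  Xmul (expoU i) (A + c *: B) = Xmul (expoU i) A + c *: Xmul (expoU i) B.
  by rewrite linearD linearZ.
rewrite -mulrA wdM wxM Dmul1_mon L.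
rewrite (Xmul_mon K (expoU i) (u.1, u.2 + expoU i)).
rewrite (Xmul_mon K (expoU i) (expo_pred u.1 i, u.2)).
have -> : (expoU i + u.1, u.2 + expoU i) = u + (expoU i, expoU i).
  by rewrite addrC.
have [->|ui] := posnP (u.1 i); first by rewrite !scale0r.
have -> // : (expoU i + expo_pred u.1 i, u.2) = u.
by rewrite addrC expo_predK // -surjective_pairing.
Qed.

Lemma wmon_wxwd i (u : mon) : wmon u * (wx i * wd i) =
  wmon (u + (expoU i, expoU i)) + (u.2 i)%:R *: wmon u :> D.
Proof.
have H (b : expo n) : Dmul b (wmon (expoU i, expoU i)) =
    wmon (expoU i, b + expoU i) + (b i)%:R *: wmon (0, b) :> D.
  elim/expo_ind: b => [|b j IH].
    by rewrite Dmul0 add0r ffunE scale0r addr0.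
  have -> : b + expoU j + expoU i = b + expoU i + expoU j by rewrite addrAC.
  rewrite DmulU IH Dmul1DZ (Dmul1_mon K j (expoU i, b + expoU i)).
  rewrite (Dmul1_mon K j (0, b)) /= [X in X%:R *: wmon (expo_pred 0 j, b)]ffunE.
  rewrite scale0r addr0 expoDE !expoUE -addrA; congr (_ + _ : D).
  have [->|ji] := eqVneq j i.
    have -> : expo_pred (expoU i) i = 0.
      by apply/ffunP => k; rewrite expo_predE expoUE subnn ffunE.
    by rewrite -scalerDl addnC natrD.
  by rewrite scale0r add0r addn0.
rewrite wxwdE wmonM H linearD linearZ /=.
rewrite (Xmul_mon K u.1 (expoU i, _)) (Xmul_mon K u.1 (0, _)) /= addr0.
by rewrite -surjective_pairing.
Qed.

(** Monomials are eigenvectors of the commutator with an Euler operator: moving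
    [x_i d_i] past [x^a d^b] changes it by the scalar [a_i - b_i]. *)
Lemma sum_wxwd_wmon (c : 'I_n -> K) (u : mon) :
  (\sum_i c i *: (wx i * wd i)) * wmon u = wmon u * (\sum_i c i *: (wx i * wd i)
    + (\sum_i c i * ((u.1 i)%:R - (u.2 i)%:R))%:A) :> D.
Proof.
by apply: sum_commE => i; [exact: wxwd_wmon|exact: wmon_wxwd].
Qed.

Lemma comm_wmon (x y P : D) (S : mon -> Prop) : supp_in S P ->
  (forall u, S u -> x * wmon u = wmon u * y) -> x * P = P * y.
Proof.
move=> PS xy.
have := @comm_sum K D _ (msupp P) (fun u => P@_u) wmon x y.
rewrite -(weylE P); apply => u; rewrite -mcoeff_neq0 => /PS; exact: xy.
Qed.

Lemma sum_wxwd_comm (c : 'I_n -> K) (l a : K) (P : D) :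
  supp_in (fun u => \sum_i c i * ((u.1 i)%:R - (u.2 i)%:R) = a) P ->
  (\sum_i c i *: (wx i * wd i) + l%:A) * P =
  P * (\sum_i c i *: (wx i * wd i) + (l + a)%:A).
Proof.
move=> Pa; rewrite [l + a]addrC scalerDl addrA; apply: commA.
apply: comm_wmon Pa _ => u <-; exact: sum_wxwd_wmon.
Qed.

End Commutation.

Section EulerOperator.
Variables (R : realType) (n : nat) (w : 'I_n -> R).
Variables (K : comNzRingType) (phi : {rmorphism R -> K}).
Local Notation D := (weyl n K).
Local Notation mon := (expo n * expo n)%type.
Local Notation wt := (wt w).

(** The operator [euler], over any coefficient ring that receives the weights. *)
Definition theta : D := \sum_i phi (w i) *: (wx i * wd i).

Lemma theta_comm (l a : R) (P : D) : supp_in (fun u => wt u = l - a) P ->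
  (theta + (phi l)%:A) * P = P * (theta + (phi a)%:A).
Proof.
move=> Pa; have -> : phi a = phi l + phi (a - l) by rewrite -rmorphD addrC subrK.
apply: sum_wxwd_comm; apply: supp_sub Pa => u ua.
rewrite -opprB -ua /wt -sumrN rmorph_sum; apply: eq_bigr => i _.
by rewrite -mulrN opprB rmorphM rmorphB !rmorph_nat.
Qed.

End EulerOperator.

Lemma horner_alg_comm (K : comNzRingType) (D : algType K) (x y P : D)
    (p : {poly K}) : x * P = P * y -> horner_alg x p * P = P * horner_alg y p.
Proof.
move=> xy; elim/poly_ind: p => [|p c IH]; first by rewrite !rmorph0 mul0r mulr0.
rewrite !rmorphD !rmorphM /= !horner_algX !horner_algC mulrDl mulrDr.
by rewrite -mulrA xy mulrA IH mulrA -scalerAl -scalerAr mul1r mulr1.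
Qed.

(** * Null-homotopies up to lower order *)

Section EulerMatrix.
Variables (R : realType) (n : nat) (w : 'I_n -> R).
Variables (K : fieldType) (phi : {rmorphism R -> K}) (b : {poly K}).
Local Notation D := (weyl n K).
Local Notation mon := (expo n * expo n)%type.
Local Notation wt := (wt w).
Local Notation mfil := (mfil w).

Definition beul (a : R) : D := horner_alg (theta w phi + (phi a)%:A) b.

Lemma beul_comm a a' (P : D) : supp_in (fun u => wt u = a - a') P ->
  beul a * P = P * beul a'.
Proof. by move=> Pa; apply: horner_alg_comm; exact: theta_comm. Qed.

Lemma wt0 : wt 0 = 0.
Proof. by rewrite /wt big1 // => i _; rewrite !ffunE subrr mulr0. Qed.

Lemma supp_wt0_one : supp_in (fun u => wt u = 0) (1 : D).
Proof. by apply: supp_wmon; exact: wt0. Qed.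

Lemma supp_wt0_mul (P Q : D) : supp_in (fun u => wt u = 0) P ->
  supp_in (fun u => wt u = 0) Q -> supp_in (fun u => wt u = 0) (P * Q).
Proof.
move=> P0 Q0; apply: supp_mul P0 Q0 => u v u0 v0.
by apply: supp_sub (@wmon_mul_wt R n w K u v) => x ->; rewrite u0 v0 addr0.
Qed.

Lemma theta_supp : supp_in (fun u => wt u = 0) (theta w phi).
Proof.
apply: supp_sum => i _ _; apply: suppZ; rewrite wxwdE; apply: supp_wmon.
by rewrite wtE wt_x wt_d addNr.
Qed.

Lemma beul_supp a : supp_in (fun u => wt u = 0) (beul a).
Proof.
rewrite /beul; elim/poly_ind: b => [|p c IH]; first by rewrite rmorph0; exact: supp0.
rewrite rmorphD rmorphM /= horner_algX horner_algC.
apply: suppD; last by apply: suppZ; exact: supp_wt0_one.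
apply: supp_wt0_mul IH _; apply: suppD; first exact: theta_supp.
by apply: suppZ; exact: supp_wt0_one.
Qed.

(** The endomorphism of the free module with shift [t] that corresponds to
    [b(theta)]: the additional [t j] makes it act on power series by the scalar
    [b(e)] in each degree [e], shifts included ([bmap_beul]). *)
Definition beul_mx q (t : 'I_q -> R) : 'M[D]_q :=
  diag_mx (\row_j beul (t j)).

Lemma beul_mxE q (t : 'I_q -> R) i j : beul_mx t i j = beul (t i) *+ (i == j).
Proof. by rewrite !mxE. Qed.

Lemma beul_mx_mull p q s (A : 'M[D]_(p, q)) i j :
  (beul_mx s *m A) i j = beul (s i) * A i j.
Proof. by rewrite mul_diag_mx !mxE. Qed.

Lemma beul_mx_mulr p q t (A : 'M[D]_(p, q)) i j :
  (A *m beul_mx t) i j = A i j * beul (t j).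
Proof. by rewrite mul_mx_diag !mxE. Qed.

Lemma beul_mx_fil q (t : 'I_q -> R) : mfil true t t (beul_mx t).
Proof.
move=> i j; rewrite beul_mxE; have [->|_] := eqVneq i j; last exact: supp0.
by apply: supp_sub (@beul_supp (t j)) => u -> /=; rewrite add0r.
Qed.

(** The matrices [beul_mx] act on free modules with different shifts compatibly
    up to terms of lower order: they commute exactly with the homogeneous part of a
    filtered matrix. *)
Lemma beul_mx_comm p q s t (A : 'M[D]_(p, q)) : mfil true s t A ->
  mfil false s t (beul_mx s *m A - A *m beul_mx t).
Proof.
move=> As; pose H : 'M[D]_(p, q) := \matrix_(i, j) hpart w (s i - t j) (A i j).
have low : mfil false s t (A - H).
  move=> i j u; rewrite !mxE wcoeffB hpart_coef.
  have [_|ue] := eqVneq (wt u) (s i - t j); first by rewrite subrr eqxx.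
  rewrite subr0 => /(As i j) /=; rewrite le_eqVlt => /orP[/eqP ue'|//].
  by rewrite -ue' addrK eqxx in ue.
have e : beul_mx s *m H = H *m beul_mx t.
  apply/matrixP => i j; rewrite beul_mx_mull beul_mx_mulr mxE.
  by apply: beul_comm; exact: hpart_supp.
have -> : beul_mx s *m A - A *m beul_mx t =
    beul_mx s *m (A - H) - (A - H) *m beul_mx t.
  by rewrite mulmxBr mulmxBl e opprB addrA subrK.
apply: mfilB; first exact: (mfilM (@beul_mx_fil _ s) low).
exact: (mfilM low (@beul_mx_fil _ t)).
Qed.

(** Lifting the null-homotopy by one degree, as for a free resolution, except
    that the homotopy relations hold only up to terms of lower order; strictness
    of the filtration keeps all the chosen matrices filtered. *)
Lemma homotopy_step p0 p1 p2 p3 (s1 : 'I_p1 -> R)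
    (s2 : 'I_p2 -> R) (s3 : 'I_p3 -> R)
    (psi0 : 'M[D]_(p1, p0)) (psi1 : 'M[D]_(p2, p1)) (psi2 : 'M[D]_(p3, p2))
    (H0 : 'M[D]_(p0, p1)) (H1 : 'M[D]_(p1, p2)) :
  psi1 *m psi0 = 0 -> mfil true s2 s1 psi1 -> mfil true s1 s2 H1 ->
  mfil false s1 s1 (beul_mx s1 - psi0 *m H0 - H1 *m psi1) ->
  (forall (X : 'rV_p2) d, mfil false (fun _ => d) s1 (X *m psi1) ->
    exists2 Q, X *m psi1 = Q *m psi1 & mfil false (fun _ => d) s2 Q) ->
  (forall (X : 'rV_p2) d, X *m psi1 = 0 -> mfil true (fun _ => d) s2 X ->
    exists2 Q, X = Q *m psi2 & mfil true (fun _ => d) s3 Q) ->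
  exists2 H2 : 'M[D]_(p2, p3), mfil true s2 s3 H2 &
    mfil false s2 s2 (beul_mx s2 - psi1 *m H1 - H2 *m psi2).
Proof.
move=> c10 f1 fH1 rel str1 str2.
pose E := beul_mx s2 - psi1 *m H1.
have Efil : mfil true s2 s2 E.
  apply: mfilB; first exact: beul_mx_fil.
  exact: (mfilM f1 fH1).
have Elow : mfil false s2 s1 (E *m psi1).
  have -> : E *m psi1 = (beul_mx s2 *m psi1 - psi1 *m beul_mx s1) +
      psi1 *m (beul_mx s1 - psi0 *m H0 - H1 *m psi1).
    rewrite !mulmxBr mulmxBl !mulmxA c10 mul0mx subr0.
    by rewrite addrA subrK.
  apply: mfilD; first exact: beul_mx_comm.
  exact: (mfilM f1 rel).
(* [E] need not be killed by [psi1], but its image has lower order, so strictness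
   yields a correction [Y] of lower order. *)
have [Y /all_and2[Yp Ylow]] : exists Y : 'M_p2, forall j,
    row j E *m psi1 = row j Y *m psi1 /\ mfil false (fun _ => s2 j) s2 (row j Y).
  apply: (row_choice (X := fun j Q => row j E *m psi1 = Q *m psi1 /\
    mfil false (fun _ => s2 j) s2 Q)) => j.
  have [|Q Q1 Q2] := str1 (row j E) (s2 j); last by exists Q.
  by rewrite -row_mul; move/mfil_row: Elow; apply.
have {}Ylow : mfil false s2 s2 Y by apply/mfil_row.
have [H2 /all_and2[EH H2f]] : exists H2 : 'M_(p2, p3), forall j,
    row j (E - Y) = row j H2 *m psi2 /\ mfil true (fun _ => s2 j) s3 (row j H2).
  apply: (row_choice (X := fun j Q => row j (E - Y) = Q *m psi2 /\
    mfil true (fun _ => s2 j) s3 Q)) => j.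
  have [||Q Q1 Q2] := str2 (row j (E - Y)) (s2 j); last by exists Q.
    by rewrite -row_mul mulmxBl linearB /= !row_mul Yp subrr.
  have : mfil true s2 s2 (E - Y) by apply: mfilB => //; exact: mfilW Ylow.
  by move/mfil_row; apply.
exists H2; first by apply/mfil_row.
have <- : E - Y = H2 *m psi2 by apply/row_matrixP => j; rewrite EH row_mul.
by rewrite opprB addrC subrK.
Qed.

End EulerMatrix.

(** * The action on power series *)

Section Evaluation.
Variables (n : nat) (K : fieldType).
Local Notation D := (weyl n K).
Local Notation mon := (expo n * expo n)%type.
Implicit Types (c : expo n -> K) (P Q : D).

(** The value at the origin of [P] applied to the power series with
    derivatives [c] there. *)
Definition ev c P : K :=
  \sum_(u <- msupp P) P@_u * (if u.1 == 0 then c u.2 else 0).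

Lemma evEw c P (d : {fset mon}) : (msupp P `<=` d)%fset ->
  ev c P = \sum_(u <- d) P@_u * (if u.1 == 0 then c u.2 else 0).
Proof.
move=> le; rewrite /ev (big_fset_incl _ le) // => u _ uP.
by rewrite (mcoeff_outdom uP) mul0r.
Qed.

Lemma ev_is_linear c : linear_for *%R (ev c).
Proof.
move=> a P Q.
pose d := (msupp P `|` msupp Q `|` msupp (a *: P + Q))%fset.
rewrite (@evEw c P d) ?(@evEw c Q d) ?(@evEw c (a *: P + Q) d).
- rewrite mulr_sumr -big_split /=; apply: eq_bigr => u _.
  by rewrite wcoeffD wcoeffZ mulrDl mulrA.
- exact: fsubsetUr.
- by rewrite /d -fsetUA fsetUCA fsubsetUl.
- by rewrite /d -fsetUA fsubsetUl.
Qed.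

HB.instance Definition _ c := GRing.isLinear.Build K D K *%R (ev c) (ev_is_linear c).

Lemma ev_eq0 c P : supp_in (fun u => u.1 = 0 -> c u.2 = 0) P -> ev c P = 0.
Proof.
move=> P0; rewrite /ev big_seq big1 // => u; rewrite -mcoeff_neq0 => /P0 cu.
by case: eqP => [/cu->|_]; rewrite mulr0.
Qed.

Lemma ev_wdmon c k : ev c (wdmon k) = c k.
Proof. by rewrite /ev msuppU oner_eq0 big_seq_fset1 mcoeffUU eqxx mul1r. Qed.

Lemma wmon_xsupp (u : mon) Q : u.1 != 0 ->
  supp_in (fun v : mon => v.1 <> 0) (wmon u * Q).
Proof.
move=> u0; have -> : wmon u * Q = Xmul u.1 (Dmul u.2 Q) by exact: wmul_mon.
apply: (supp_lin (f := Xmul u.1) (S := fun _ => True)) => // v _.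
rewrite /= Xmul_mon; apply: supp_wmon => /= e; case/eqP: u0; apply/ffunP => i.
by have /ffunP/(_ i)/eqP := e; rewrite expoDE ffunE addn_eq0 => /andP[/eqP-> _].
Qed.

Lemma ev_xmul c (u : mon) Q : u.1 != 0 -> ev c (wmon u * Q) = 0.
Proof. by move=> u0; apply: ev_eq0; apply: supp_sub (wmon_xsupp u0) => v. Qed.

(** The derivatives at the origin of [Q] applied to the power series with
    derivatives [c]. *)
Definition act Q c : expo n -> K := fun k => ev c (wdmon k * Q).

Lemma lin_wmon (f g : {linear D -> K | *%R}) P :
  (forall u, f (wmon u) = g (wmon u)) -> f P = g P.
Proof.
move=> fg; rewrite (weylE P) !linear_sum; apply: eq_bigr => u _.
by rewrite !linearZ fg.
Qed.

(** Evaluation kills the right ideal generated by the variables, so only the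
    part of [P] that is free of variables matters. *)
Lemma ev_mul c P Q : ev c (P * Q) = ev (act Q c) P.
Proof.
apply: (@lin_wmon (ev c \o wmulr Q) (ev (act Q c))) => u.
have evu : ev (act Q c) (wmon u) = if u.1 == 0 then act Q c u.2 else 0.
  by rewrite /ev msuppU oner_eq0 big_seq_fset1 mcoeffUU mul1r.
rewrite /= evu.
case: eqP => [u0|/eqP u0]; last exact: ev_xmul.
by rewrite [u in LHS]surjective_pairing u0.
Qed.

Lemma ev_sum_fun (I : finType) (c : I -> expo n -> K) P :
  ev (fun k => \sum_i c i k) P = \sum_i ev (c i) P.
Proof.
rewrite /ev exchange_big /=; apply: eq_bigr => u _.
by rewrite -mulr_sumr; congr (_ * _); case: eqP => //; rewrite big1.
Qed.

Variables (R : realType) (w : 'I_n -> R) (phi : {rmorphism R -> K}).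

Lemma ev_theta c P : ev c (theta w phi * P) = 0.
Proof.
rewrite /theta mulr_suml linear_sum big1 // => i _.
rewrite -scalerAl linearZ /= -mulrA ev_xmul ?mulr0 //.
by apply/eqP => /ffunP/(_ i); rewrite expoUE eqxx ffunE.
Qed.

(** [theta] lies in the right ideal generated by the variables, so that evaluation
    sees [theta + a] as the scalar [a]. *)
Lemma ev_beul c b a P : ev c (beul w phi b a * P) = b.[phi a] * ev c P.
Proof.
rewrite /beul; elim/poly_ind: b P => [|b x IH] P.
  by rewrite rmorph0 mul0r linear0 horner0 mul0r.
rewrite rmorphD rmorphM /= horner_algX horner_algC hornerMXaddC.
rewrite mulrDl -scalerAl mul1r linearD linearZ /= mulrDl; congr (_ + _).
rewrite -(mulrA (horner_alg _ b)) IH -[RHS]mulrA; congr (_ * _).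
by rewrite mulrDl -scalerAl mul1r linearD linearZ /= ev_theta add0r.
Qed.

End Evaluation.

Lemma seq_min (R : realType) (A : eqType) (f : A -> R) (s : seq A) : s != [::] ->
  exists2 x, x \in s & forall y, y \in s -> f x <= f y.
Proof.
elim: s => // a [|b s] IH _.
  by exists a => [|y]; rewrite inE // => /eqP->.
have [//|x xs xmin] := IH; have [ax|xa] := leP (f a) (f x).
  exists a => [|y]; rewrite inE ?eqxx // => /orP[/eqP->//|/xmin].
  exact: le_trans.
exists x => [|y]; rewrite in_cons ?xs ?orbT // => /orP[/eqP->|/xmin//].
exact: ltW.
Qed.

Section BarMaps.
Variables (R : realType) (n : nat) (w : 'I_n -> R).
Variables (K : fieldType) (phi : {rmorphism R -> K}).
Local Notation D := (weyl n K).
Local Notation mon := (expo n * expo n)%type.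
Local Notation kv q := (expo n * 'I_q -> K).

Definition bmap p q (A : 'M[D]_(p, q)) (c : kv q) : kv p :=
  fun x => \sum_l ev (fun k => c (k, l)) (wdmon x.1 * A x.2 l).

Definition degix q (t : 'I_q -> R) (x : expo n * 'I_q) : R := wdot w x.1 + t x.2.

(** The functions [bmap A] are the action of [A] on vectors of power series, in
    coordinates; hence they compose like the matrices. *)
Lemma bmap_mul p q r (A : 'M[D]_(p, q)) (B : 'M[D]_(q, r)) (c : kv r) :
  bmap (A *m B) c = bmap A (bmap B c).
Proof.
apply/funext => x; rewrite /bmap.
under [RHS]eq_bigr do rewrite ev_sum_fun.
rewrite exchange_big /=; apply: eq_bigr => l _.
rewrite mxE mulr_sumr linear_sum; apply: eq_bigr => k _ /=.
by rewrite (mulrA (wdmon _)); exact: ev_mul.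
Qed.

Lemma bmapB p q (A B : 'M[D]_(p, q)) (c : kv q) x :
  bmap (A - B) c x = bmap A c x - bmap B c x.
Proof.
rewrite /bmap -sumrB; apply: eq_bigr => l _.
by rewrite !mxE mulrBr linearB.
Qed.

Lemma bmap0 p q (c : kv q) x : bmap (0 : 'M[D]_(p, q)) c x = 0.
Proof. by rewrite /bmap big1 // => l _; rewrite mxE mulr0 linear0. Qed.

Lemma bmap_lin p q (A : 'M[D]_(p, q)) (a : K) (c d : kv q) x :
  bmap A (fun y => a * c y + d y) x = a * bmap A c x + bmap A d x.
Proof.
rewrite /bmap mulr_sumr -big_split; apply: eq_bigr => l _ /=.
rewrite /ev mulr_sumr -big_split; apply: eq_bigr => u _ /=.
by case: ifP => _; rewrite ?mulr0 ?addr0 // mulrDr mulrCA.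
Qed.

Lemma wt_wdot k : wt w (0, k) = wdot w k.
Proof. by apply: eq_bigr => i _; rewrite /= ffunE subr0. Qed.

(** Block triangularity: an output in some degree depends only on inputs of at
    most that degree, or of smaller degree if [A] lowers orders strictly. *)
Lemma bmap_eq0 C p q s t (A : 'M[D]_(p, q)) (c : kv q) x : mfil w C s t A ->
  (forall y, degix t y < degix s x ?<= if C -> c y = 0) -> bmap A c x = 0.
Proof.
move=> As c0; rewrite /bmap big1 // => l _; apply: ev_eq0.
apply: (supp_mul (S := fun u => u = (0, x.1))) (As x.2 l); last exact: supp_wmon.
move=> _ v -> /= vs; apply: supp_sub (@wmon_mul_wt R n w K (0, x.1) v) => u ue u0.
apply: c0; rewrite /degix /= -wt_wdot.
have -> : (0, u.2) = u by rewrite [u in RHS]surjective_pairing u0.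
by rewrite ue wt_wdot -addrA lteifD2l.
Qed.

Lemma bmap_low p q s t (A : 'M[D]_(p, q)) (c d : kv q) x : mfil w true s t A ->
  (forall y, degix t y <= degix s x -> c y = d y) -> bmap A c x = bmap A d x.
Proof.
move=> As cd; have := bmap_lin A (-1) d c x.
rewrite (bmap_eq0 As) => [/esym/eqP|y /= /cd ->]; last by rewrite mulN1r addNr.
by rewrite mulN1r addrC subr_eq0 => /eqP.
Qed.

(** Moving [d^k] to the right of [b(theta + t)] turns [theta] into [theta + w . k],
    and evaluation then leaves [b] at the degree [w . k + t]. *)
Lemma bmap_beul b q (t : 'I_q -> R) (c : kv q) x :
  bmap (beul_mx w phi b t) c x = b.[phi (degix t x)] * c x.
Proof.
rewrite /bmap (bigD1 x.2) //= big1 ?addr0 => [|l lx]; last first.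
  by rewrite beul_mxE eq_sym (negPf lx) mulr0n mulr0 linear0.
rewrite beul_mxE eqxx mulr1n -(@beul_comm _ _ w _ phi b (degix t x)); last first.
  by apply: supp_wmon; rewrite /degix addrK wt_wdot.
by rewrite ev_beul ev_wdmon -surjective_pairing.
Qed.

Hypothesis w_gt0 : forall i, 0 < w i.

Lemma bounded_degix q (t : 'I_q -> R) (m : R) :
  exists L : seq (expo n * 'I_q), forall x, degix t x <= m -> x \in L.
Proof.
pose B := Num.bound (\sum_i \sum_j `|(m - t j) / w i|).
have [s sP] := bounded_expo n B.
exists [seq (a, j) | a <- s, j <- enum 'I_q] => -[a j] xm.
apply: allpairs_f; last by rewrite mem_enum.
apply: sP => i; rewrite -(ler_nat R) ltW //.
apply: le_lt_trans (archi_boundP _); last by do 2 (apply: sumr_ge0 => ? _).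
rewrite (bigD1 i) //= (bigD1 j) //= -addrA.
apply: (@le_trans _ _ `|(m - t j) / w i|).
  apply: le_trans (ler_norm _); rewrite ler_pdivlMr // mulrC.
  rewrite lerBrDr; apply: le_trans xm; rewrite lerD2r /wdot (bigD1 i) //= lerDl.
  by apply: sumr_ge0 => k _; rewrite mulr_ge0 // ltW.
by rewrite lerDl addr_ge0 //; do ? (apply: sumr_ge0 => ? _).
Qed.

(** At a degree where [b] does not vanish, the homotopy relation exhibits the
    lowest part of [v] as a boundary; removing it raises the degree in which [v]
    starts, and only finitely many degrees up to [m'] occur. *)
Theorem acyclicity b p0 p1 p2 s0 s1 s2 (psi0 : 'M[D]_(p1, p0))
    (psi1 : 'M[D]_(p2, p1)) (H0 : 'M[D]_(p0, p1)) (H1 : 'M[D]_(p1, p2)) (m m' : R) :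
  psi1 *m psi0 = 0 -> mfil w true s1 s0 psi0 ->
  mfil w true s0 s1 H0 -> mfil w true s1 s2 H1 ->
  mfil w false s1 s1 (beul_mx w phi b s1 - psi0 *m H0 - H1 *m psi1) ->
  (forall x, m < degix s1 x -> b.[phi (degix s1 x)] != 0) ->
  forall v, (forall x, degix s1 x <= m -> v x = 0) ->
  (forall x, degix s2 x <= m' -> bmap psi1 v x = 0) ->
  exists2 e, forall x, degix s0 x <= m -> e x = 0 &
    forall x, degix s1 x <= m' -> v x = bmap psi0 e x.
Proof.
move=> c10 f0 fH0 fH1 rel bn0 v.
have [L LP] := bounded_degix s1 m'.
pose above l := [pred x | l < degix s1 x <= m'].
suff main k : forall (l : R) (v : kv p1), m <= l -> (count (above l) L < k)%N ->
    (forall x, degix s1 x <= l -> v x = 0) ->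
    (forall x, degix s2 x <= m' -> bmap psi1 v x = 0) ->
    exists2 e, forall x, degix s0 x <= m -> e x = 0 &
      forall x, degix s1 x <= m' -> v x = bmap psi0 e x.
  by move=> v0 dv; apply: (main (count (above m) L).+1 m).
elim: k => // k IH l {}v ml ltk v0 dv.
have [L0|] := eqVneq (filter (above l) L) [::].
  exists (fun _ => 0) => // x xm'.
  rewrite (bmap_eq0 f0) // v0 // leNgt; apply/negP => lx.
  by have := in_nil x; rewrite -L0 mem_filter /= lx xm' LP.
move=> /(@seq_min _ _ (degix s1))[x0]; rewrite mem_filter.
move=> /andP[/andP[lx0 x0m'] x0L] x0min; set d := degix s1 x0 in lx0 x0m'.
have v_low x : degix s1 x < d -> v x = 0.
  move=> xd; apply: v0; rewrite leNgt; apply/negP => lx.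
  have xm' := le_trans (ltW xd) x0m'.
  have : x \in filter (above l) L by rewrite mem_filter /= lx xm' LP.
  by move=> /x0min; rewrite leNgt xd.
have dn0 : b.[phi d] != 0 by apply: bn0; exact: le_lt_trans ml lx0.
(* In degree [d] the relation reads [b(d) v = psi0 H0 v]: the other summand is
   [H1 (psi1 v)], and [psi1 v] vanishes up to degree [m']. *)
pose a := (b.[phi d])^-1; pose e0 : kv p0 := fun y => a * bmap H0 v y + 0.
have e0_low y : degix s0 y < d -> e0 y = 0.
  move=> yd; rewrite /e0 addr0 (bmap_eq0 fH0) ?mulr0 // => z /= zy.
  by apply: v_low; exact: le_lt_trans yd.
pose v' : kv p1 := fun x => (-1) * bmap psi0 e0 x + v x.
have e0E x : bmap psi0 e0 x = a * bmap (psi0 *m H0) v x.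
  by rewrite bmap_lin bmap_mul [X in _ + X](bmap_eq0 f0) ?addr0.
have [||||e e_low eE] := IH d v'.
- exact: le_trans ml (ltW lx0).
- have sub : subpred (above d) (above l).
    by move=> x /= /andP[dx ->]; rewrite (lt_trans lx0 dx).
  have := count_predUI (pred1 x0) (above d) L.
  rewrite (@eq_count _ (predI _ _) pred0) ?count_pred0 ?addn0; last first.
    by move=> x /=; case: eqP => //= ->; rewrite ltxx.
  move=> eL; rewrite -ltnS; apply: leq_trans ltk; rewrite ltnS.
  have sub' : subpred (predU (pred1 x0) (above d)) (above l).
    by move=> x /= /orP[/eqP->|/sub//]; rewrite lx0 x0m'.
  apply: leq_trans (sub_count sub' L); rewrite eL -add1n leq_add2r.
  by rewrite -has_count has_pred1.
- move=> x; rewrite le_eqVlt /v' => /orP[/eqP xd|xd]; last first.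
    rewrite v_low // (bmap_eq0 f0) ?mulr0 ?addr0 // => y /= yx.
    by apply: e0_low; exact: le_lt_trans xd.
  have vx y : degix s1 y < degix s1 x -> v y = 0 by rewrite xd; exact: v_low.
  have := bmap_eq0 rel vx; rewrite !bmapB bmap_beul xd (bmap_mul H1).
  rewrite (bmap_eq0 fH1) => [|y /= yx]; last first.
    by apply: dv; apply: le_trans yx _; rewrite xd.
  rewrite subr0 => /eqP; rewrite subr_eq0 => /eqP h.
  by rewrite e0E -h [a * _]mulrA /a mulVf // mul1r mulN1r addNr.
- by move=> x xm'; rewrite bmap_lin dv // addr0 -bmap_mul c10 bmap0 mulr0.
exists (fun y => 1 * e0 y + e y) => [y ym|x xm'].
  by rewrite e_low // e0_low ?mulr0 ?addr0 //; apply: le_lt_trans ym _; apply: le_lt_trans lx0.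
by rewrite bmap_lin mul1r -eE // /v' mulN1r addNKr.
Qed.

End BarMaps.

(** * Adapted resolutions *)

Section Resolution.
Variables (R : realType) (n : nat) (w : 'I_n -> R).
Local Notation K := R[i].
Local Notation D := (weyl n K).
Local Notation phi := (real_complex R).
Local Notation rsh t := (fun j => (t j)%:~R : R).
Variables (I : D -> Prop) (b : nat -> nat).
Variables (psi : forall i, 'M[D]_(rk b i.+1, rk b i)).
Local Notation kerN i := (@out_ker R n I b psi i).
Variables (sh : forall i, 'I_(rk b i) -> int).
Hypothesis adapted : adapted_resolution w I psi sh.

Lemma res_fil i : mfil w true (rsh (@sh i.+1)) (rsh (@sh i)) (psi i).
Proof. by apply: psi_fil => j; exact: (adapted_shift adapted). Qed.

Lemma out_kerP i Q : kerN i Q <-> exists X, Q = X *m psi i.+1.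
Proof.
have [h1 h2] := adapted_ker adapted Q.
have [g1 g2] := submod_gen_rows (psi i.+1) Q.
by split=> [/h1/g1|/g2/h2].
Qed.

Lemma out_ker_sub i : is_submod (kerN i).
Proof.
have -> : kerN i = submod_gen (fun S => exists j, S = row j (psi i.+1)).
  by apply/funext => Q; apply/propext; exact: (adapted_ker adapted Q).
exact: submod_gen_sub.
Qed.

Lemma res_strict i C P d : kerN i P ->
  mfil w C (fun _ => d) (rsh (@sh i.+1)) P ->
  exists2 Q, P = Q *m psi i.+1 & mfil w C (fun _ => d) (rsh (@sh i.+2)) Q.
Proof.
have appr := approx_of_init (adapted_shift adapted (i := i.+1))
  (fun Q => proj1 (adapted_init adapted Q)).
exact: (strictness (@out_ker_sub i) (@out_kerP i) appr).
Qed.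

Lemma res_comp i : psi i.+1 *m psi i = 0.
Proof.
case: i => [|i]; first by apply/matrixP => ? [].
apply/row_matrixP => j; rewrite row_mul row0.
have [_ ker] := out_kerP (row j (psi i.+2)).
by apply: ker; exists (delta_mx 0 j); rewrite -rowE.
Qed.

Variable bf : {poly K}.
Hypothesis bf_bfun : is_bfunction w I bf.
Local Notation beulm t := (beul_mx w phi bf (rsh t)).

Lemma bfun_init : init_submod w (@sh 1%N) (kerN 0%N)
  (const_mx (beul w phi bf 0) : 'rV[D]_1).
Proof.
have [_ bfP] := bf_bfun; have [_ /(_ (dvdpp bf))] := bfP bf.
have -> : @sh 1%N = fun _ => 0.
  by apply/funext => j; exact: (adapted_shift0 adapted).
have -> // : beul w phi bf 0 = horner_alg (euler w) bf.
rewrite /beul rmorph0 scale0r addr0 //.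
Qed.

(** By definition of the [b]-function, [b(theta)] is in the initial ideal, hence it
    is a combination of the rows of [psi 1] up to terms of lower order. *)
Lemma homotopy0 : exists2 H : 'M[D]_(rk b 1, rk b 2),
  mfil w true (rsh (@sh 1%N)) (rsh (@sh 2)) H &
  mfil w false (rsh (@sh 1%N)) (rsh (@sh 1%N)) (beulm (@sh 1%N) - H *m psi 1).
Proof.
have sh1 : (fun j => (@sh 1%N j)%:~R : R) = fun _ => 0.
  by apply/funext => j; rewrite (adapted_shift0 adapted).
have gen := proj1 (adapted_init adapted _) bfun_init.
have [|H Hf Hl] := init_lift (adapted_shift adapted (i := 1%N)) (e := 0) _ gen.
  move=> l; rewrite mxE (adapted_shift0 adapted) subr0; exact: beul_supp.
exists H; first by rewrite sh1.
rewrite {1}sh1; have -> // : beulm (@sh 1%N) = const_mx (beul w phi bf 0).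
by apply/matrixP => i j; rewrite beul_mxE !ord1 eqxx mxE (adapted_shift0 adapted).
Qed.

(** Up to terms of lower order the maps [beulm] are null-homotopic on the
    resolution. *)
Lemma homotopy i : exists (H0 : 'M[D]_(rk b i, rk b i.+1))
    (H1 : 'M[D]_(rk b i.+1, rk b i.+2)),
  [/\ mfil w true (rsh (@sh i)) (rsh (@sh i.+1)) H0,
      mfil w true (rsh (@sh i.+1)) (rsh (@sh i.+2)) H1 &
      mfil w false (rsh (@sh i.+1)) (rsh (@sh i.+1))
        (beulm (@sh i.+1) - psi i *m H0 - H1 *m psi i.+1)].
Proof.
elim: i => [|i [H0 [H1 [f0 f1 rel]]]].
  have [H Hf Hl] := homotopy0; exists 0, H.
  by split; [exact: mfil0|exact: Hf|rewrite mulmx0 subr0; exact: Hl].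
have [||H2 f2 rel2] := homotopy_step (psi2 := psi i.+2) (s3 := rsh (@sh i.+3))
    (res_comp i) (@res_fil i.+1) f1 rel.
- move=> X d Xl; apply: res_strict Xl; apply/out_kerP; by exists X.
- by move=> X d X0; exact: (@res_strict i.+1).
by exists H1, H2.
Qed.

End Resolution.

(** * Truncated complexes *)

Section Truncation.
Variables (R : realType) (n : nat) (w : 'I_n -> R).
Local Notation K := R[i].
Local Notation D := (weyl n K).
Local Notation rsh t := (fun j => (t j)%:~R : R).

Lemma bar_mapE p q (A : 'M[D]_(p, q)) (c : kvec R n q) : bar_map A c = bmap A c.
Proof.
apply/funext => x; apply: eq_bigr => l _; rewrite /ev big_mkcond.
apply: eq_bigr => u _ /=; case: eqP => u0; last by rewrite mulr0.
by rewrite /bar_entry /= [u in RHS]surjective_pairing u0.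
Qed.

Lemma bmap_linear p q (A : 'M[D]_(p, q)) a (c d : kvec R n q) x :
  bmap A (a *: c + d : kvec R n q) x = a * bmap A c x + bmap A d x.
Proof. exact: bmap_lin. Qed.

Variables (p q : nat) (s : 'I_p -> int) (t : 'I_q -> int) (A : 'M[D]_(p, q)).
Hypothesis A_fil : mfil w true (rsh s) (rsh t) A.
Implicit Types (m : int) (c : kvec R n q).

Lemma tau_mapE m c x :
  tau_map w s t m A c x = if ideg w s x <= m%:~R then bmap A c x else 0.
Proof.
rewrite /tau_map /trunc bar_mapE; case: leP => // xm; apply: (bmap_low A_fil) => y yx.
by rewrite (le_trans yx xm).
Qed.

Lemma tau_kerP m c : tau_ker w s t m A c <->
  kvec_le w t m c /\ forall x, ideg w s x <= m%:~R -> bmap A c x = 0.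
Proof.
split=> -[cm Ac]; (split; first exact: cm).
  by move=> x xm; have := congr1 (fun f => f x) Ac; rewrite tau_mapE xm.
by apply/funext => x; rewrite tau_mapE; case: leP => // /Ac.
Qed.

(** By triangularity, entries of a preimage above the truncation degree do not
    matter, so the preimage need not be truncated. *)
Lemma tau_imP m (c : kvec R n p) : tau_im w s t m A c <->
  kvec_le w s m c /\ exists e : kvec R n q, forall x, ideg w s x <= m%:~R -> c x = bmap A e x.
Proof.
split=> [[e _ ->]|[cm [e ce]]].
  split=> [x|]; first by rewrite tau_mapE ltNge; case: leP.
  by exists e => x xm; rewrite tau_mapE xm.
exists (trunc w t m e) => [x|]; first by rewrite /trunc ltNge; case: leP.
apply/funext => x; rewrite tau_mapE; case: leP => [xm|/cm//].
rewrite ce //; apply: (bmap_low A_fil) => y yx.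
by rewrite /trunc (le_trans yx xm).
Qed.

End Truncation.

Lemma lin_submod (K : fieldType) (V : lmodType K) (S : V -> Prop) :
  S 0 -> (forall a u v, S u -> S v -> S (a *: u + v)) -> is_submod S.
Proof.
move=> S0 SL; split=> // [u v Su Sv|a u Su].
  by rewrite -[u]scale1r; exact: SL.
by rewrite -[_ *: _]addr0; exact: SL.
Qed.

Theorem theorem3p1 (R : realType) (n : nat) (w : 'I_n -> R)
    (I : weyl n R[i] -> Prop)
    (b : nat -> nat)
    (psi : forall i, 'M[weyl n R[i]]_(rk b i.+1, rk b i))
    (sh : forall i, 'I_(rk b i) -> int)
    (bf : {poly R[i]}) (k1 m m' : int) (d : nat) :
  (forall i, 0 < w i) ->
  is_left_ideal I ->
  holonomic I ->
  adapted_resolution w I psi sh ->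
  is_bfunction w I bf ->
  is_max_integral_root bf k1 ->
  degree_roots_le w bf k1 ->
  k1 <= m -> m < m' ->
  let A := psi d.+1 in
  let B := psi d in
  let s := @sh d.+2 in
  let t := @sh d.+1 in
  let u := @sh d in
  induces_iso (tau_ker w s t m' A) (tau_im w t u m' B)
    (tau_ker w s t m A) (tau_im w t u m B)
    (trunc w t m).
Proof.
move=> w0 _ _ adapted bfun _ bf_le k1m mm' A B s t u.
have mle : m%:~R <= m'%:~R :> R by rewrite ler_int ltW.
have bn0 i (x : expo n * 'I_(rk b i)) :
    m%:~R < ideg w (@sh i) x -> bf.[real_complex R (ideg w (@sh i) x)] != 0.
  apply: contraTneq => /eqP bf0; rewrite -leNgt.
  apply: le_trans (bf_le x.1 (sh i x.2) bf0) _; by rewrite ler_int.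
have acyc i (v : kvec R n (rk b i.+1)) :
    (forall x, ideg w (@sh i.+1) x <= m%:~R -> v x = 0) ->
    (forall x, ideg w (@sh i.+2) x <= m'%:~R -> bmap (psi i.+1) v x = 0) ->
    exists2 e : kvec R n (rk b i), forall x, ideg w (@sh i) x <= m%:~R -> e x = 0 &
      forall x, ideg w (@sh i.+1) x <= m'%:~R -> v x = bmap (psi i) e x.
  have [H0 [H1 [f0 f1 rel]]] := homotopy adapted bfun i.
  exact: (acyclicity w0 (res_comp adapted i) (res_fil adapted (i := i)) f0 f1 rel
    (bn0 i.+1)).
have fA := res_fil adapted (i := d.+1); have fB := res_fil adapted (i := d).
have AB (e : kvec R n _) x : bmap A (bmap B e) x = 0.
  by rewrite -bmap_mul (res_comp adapted) bmap0.
have tauk := tau_kerP fA; have taui := tau_imP fB.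
have ker_sub k : is_submod (tau_ker w s t k A).
  apply: lin_submod => [|a c c' /tauk[c1 c2] /tauk[d1 d2]]; apply/tauk.
    split=> // x _; exact: (bmap_eq0 fA).
  split=> x xk; first by rewrite -[LHS]/(a * c x + c' x) c1 // d1 // mulr0 addr0.
  by rewrite bmap_linear c2 // d2 // mulr0 addr0.
have im_sub k : is_submod (tau_im w t u k B).
  apply: lin_submod => [|a c c' /taui[c1 [e ce]] /taui[d1 [e' de]]]; apply/taui.
    split=> //; exists 0 => x _; symmetry; exact: (bmap_eq0 fB).
  split=> [x xk|]; first by rewrite -[LHS]/(a * c x + c' x) c1 // d1 // mulr0 addr0.
  exists (a *: e + e') => x xk.
  by rewrite bmap_linear -[LHS]/(a * c x + c' x) ce // de.
have im_ker k (c : kvec R n _) : tau_im w t u k B c -> tau_ker w s t k A c.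
  move=> /taui[c1 [e ce]]; apply/tauk; split=> // x xk.
  rewrite -(AB e x); apply: (bmap_low fA) => y yx; apply: ce.
  exact: le_trans yx xk.
split=> //; first by split=> c; exact: im_ker.
  move=> a c c'; apply/funext => x; rewrite -[RHS]/(a * trunc w t m c x + trunc w t m c' x).
  by rewrite /trunc; case: ifP => // _; rewrite mulr0 addr0.
split.
- move=> c /tauk[c1 c2]; apply/tauk; split=> [x|x xm].
    by rewrite /trunc ltNge; case: leP.
  rewrite -(c2 x (le_trans xm mle)); apply: (bmap_low fA) => y yx.
  by rewrite /trunc (le_trans yx xm).
- move=> c /taui[c1 [e ce]]; apply/taui; split=> [x|].
    by rewrite /trunc ltNge; case: leP.
  by exists e => x xm; rewrite /trunc xm ce // (le_trans xm mle).
- (* Injectivity: if the truncation of [c] to [m] is the image of [e], then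
     [c - B e] starts above [m], where the complex is exact. *)
  move=> c /tauk[c1 c2] /taui[_ [e ce]].
  pose v : kvec R n _ := (-1) *: (bmap B e : kvec R n _) + c.
  have [x xm|x xm'|e' _ ve'] := acyc d v.
  + rewrite -[LHS]/(-1 * bmap B e x + c x) -(ce x xm) /trunc xm.
    by rewrite mulN1r addNr.
  + by rewrite bmap_linear AB c2 // mulr0 addr0.
  apply/taui; split=> //; exists (1 *: e + e') => x xm'.
  rewrite bmap_linear mul1r -(ve' x xm').
  by rewrite -[v x]/(-1 * bmap B e x + c x) mulN1r addNKr.
(* Surjectivity: the obstruction [A c'] to lifting [c'] starts above [m] and is a
   cocycle, so it is the image of some [e] that starts above [m]; then [c' - e]
   lifts [c']. *)
move=> c' /tauk[c1 c2].
have [x|x xm'|e e0 ce] := acyc d.+1 (bmap A c').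
- exact: c2.
- by rewrite -bmap_mul (res_comp adapted) bmap0.
pose c : kvec R n _ := trunc w t m' ((-1) *: e + c').
exists c.
  apply/tauk; split=> [x|x xm']; first by rewrite /c /trunc ltNge; case: leP.
  have -> : bmap A c x = bmap A ((-1) *: e + c' : kvec R n _) x.
    by apply: (bmap_low fA) => y yx; rewrite /c /trunc (le_trans yx xm').
  by rewrite bmap_linear -(ce x xm') mulN1r addNr.
have -> : c' - trunc w t m c = 0.
  apply/funext => x; rewrite -[LHS]/(c' x - trunc w t m c x) /c /trunc.
  case: leP => [xm|/c1->]; last by rewrite subr0.
  rewrite (le_trans xm mle) -[X in _ - X]/(-1 * e x + c' x) e0 //.
  by rewrite mulr0 add0r subrr.
by have [] := im_sub m.
Qed.
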